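(* Let $Q\subset\mathbb{R}^2$ be a polygonal region and let $r,\varepsilon>0$. The algorithm $\textsc{Decide}(Q,r,\varepsilon)$ returns YES if and only if there exists a polygonal region $P$ such that $\mathrm{offset}(P,r)$ is $\varepsilon$-close to $Q$.
   Context: A polygonal region is a (closed) set $X\subset\mathbb{R}^2$ whose boundary consists of finitely many line segments (possibly degenerate to points) with disjoint interiors. The input $Q$ is nonempty and bounded, not necessarily connected. $D_s(c)$ is the closed disk of radius $s$ around $c$, $D_s:=D_s(0)$, and $X^C:=\mathbb{R}^2\setminus X$. Define $\mathrm{offset}(X,s):=X\oplus D_s$ (Minkowski sum) and $\mathrm{inset}(X,s):=\mathrm{offset}(X^C,s)^C=\{x\in\mathbb{R}^2\mid D_s(x)\subseteq X\}$. Closed sets $X,Y$ are $\varepsilon$-close if their symmetric Hausdorff distance $H(X,Y)=\max\{\max_{x\in X}d(x,Y),\max_{y\in Y}d(y,X)\}$ is at most $\varepsilon$. Algorithm $\textsc{Decide}(Q,r,\varepsilon)$: (1) $Q_\varepsilon:=\mathrm{offset}(Q,\varepsilon)$; (2) $\Pi:=\mathrm{inset}(Q_\varepsilon,r)$; (3) $Q':=\mathrm{offset}(\Pi,r+\varepsilon)$; (4) return YES if $Q\subseteq Q'$, otherwise NO. (If $r\le\varepsilon$ the answer is YES, since $P:=Q$ works.) *)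

(* Defs.v *)
From mathcomp Require Import all_boot all_order all_algebra.
From mathcomp Require Import all_classical all_reals all_analysis.

Set Implicit Arguments.
Unset Strict Implicit.
Unset Printing Implicit Defensive.

Import Order.TTheory GRing.Theory Num.Theory.
Import numFieldNormedType.Exports.

Local Open Scope classical_set_scope.
Local Open Scope ring_scope.

(* The library norm on R * R is the sup norm. It is used below only through
   the topology it induces and through boundedness, neither of which depends
   on the choice of norm; all distances are Euclidean. *)
Notation plane R := (R * R)%type.

Section Plane.
Context {R : realType}.
Implicit Types (x y a b c : plane R) (X Y Q P : set (plane R)) (s r e : R).

Definition edistance x y : R :=
  Num.sqrt ((x.1 - y.1) ^+ 2 + (x.2 - y.2) ^+ 2).

Definition disk s c : set (plane R) := [set x | edistance c x <= s].

Definition minkowski_sum X Y : set (plane R) := [set x + y | x in X & y in Y].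

Definition offset X s : set (plane R) := minkowski_sum X (disk s 0).

Definition inset X s : set (plane R) := ~` offset (~` X) s.

Definition boundary X : set (plane R) := closure X `\` interior X.

Definition segment a b : set (plane R) :=
  [set ((1 - t) * a.1 + t * b.1, (1 - t) * a.2 + t * b.2) | t in `[0, 1]].

(* Relative interior; for a degenerate segment this is the point itself. *)
Definition segment_interior a b : set (plane R) :=
  [set ((1 - t) * a.1 + t * b.1, (1 - t) * a.2 + t * b.2) | t in `]0, 1[].

(* The empty set, the whole plane and unbounded sets are not excluded. *)
Definition polygonal_region X : Prop :=
  closed X /\
  exists (n : nat) (a b : 'I_n -> plane R),
    trivIset [set: 'I_n] (fun i => segment_interior (a i) (b i)) /\
    boundary X = \bigcup_(i in [set: 'I_n]) segment (a i) (b i).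

Definition distance_to_set x Y : \bar R :=
  ereal_inf [set (edistance x y)%:E | y in Y].

(* Extended-real valued: equal to +oo when exactly one of the two sets is
   empty, or exactly one of them is bounded. *)
Definition hausdorff_distance X Y : \bar R :=
  maxe (ereal_sup [set distance_to_set x Y | x in X])
       (ereal_sup [set distance_to_set y X | y in Y]).

Definition eps_close e X Y : Prop := (hausdorff_distance X Y <= e%:E)%E.

(* The answers YES and NO are true and false. *)
Definition decide Q r e : bool :=
  let Qe := offset Q e in
  let Pi := inset Qe r in
  let Q' := offset Pi (r + e) in
  `[< Q `<=` Q' >].

End Plane.

(* Main.v *)
Require Import Defs.
From mathcomp Require Import all_boot all_order all_algebra.
From mathcomp Require Import all_classical all_reals all_analysis.
From mathcomp Require Import ring lra.
Set Implicit Arguments.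
Unset Strict Implicit.
Unset Printing Implicit Defensive.

Import Order.TTheory GRing.Theory Num.Theory.
Import numFieldNormedType.Exports.
Local Open Scope classical_set_scope.
Local Open Scope ring_scope.

(* Let Pi be the set of centers of disks of radius r inside offset(Q, eps).  By
   compactness, eps-closeness of offset(P, r) to Q means that P lies in Pi and
   that Q lies in offset(P, r + eps), so a solution P makes DECIDE answer YES.
   For the converse with r <= eps take P = Q.  With eps < r a finite subset P of
   Pi already suffices; by compactness only the points q of Q at distance exactly
   s = r + eps from Pi matter.  Polygonality enters only through the fact that Q
   is a cone near each of its points.  It is enough to find, for each direction d
   of Q at q, a center p in Pi with |q - p| = s and <d, q - p> < 0: this p covers
   the points of Q near q in all directions close to d.  If there is none,
   then the centers covering q + h d accumulate, as h -> 0, at some p with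
   <d, q - p> = 0.  In coordinates with p = 0, q = (0, s) and d pointing along
   the first axis, the disks of radius r around p and around a nearby center p',
   together with the neighbourhood of q + [0, t] d, fill a region that contains
   a disk of radius r whose center is closer to q than s, a contradiction.  The
   cone condition excludes holes of offset(Q, eps) in the gap between the two
   disks and the neighbourhood of the segment. *)

(** * Compactness as a local-to-global principle *)

(** If [K] were not in the ideal [G], the sets whose complement in [K] lies in [G] would form a
    proper filter containing [K], and the local hypothesis would fail at a cluster point of it. *)
Lemma compact_ideal_local (T : topologicalType) (K : set T)
    (G : set T -> Prop) :
  compact K -> G set0 ->
  (forall A B, A `<=` B -> G B -> G A) ->
  (forall A B, G A -> G B -> G (A `|` B)) ->
  (forall k, K k -> exists2 V, nbhs k V & G (K `&` V)) -> G K.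
Proof.
move=> cK G0 Gsub GU Gloc; apply: contrapT => nGK.
pose F : set_system T := [set S | G (K `\` S)].
have FF : Filter F.
  split=> [|S S' FS FS'|S S' SS' FS]; rewrite /F /=.
  - by rewrite setDT.
  - by rewrite setDIr; exact: GU.
  - by apply: Gsub FS; exact: setDS.
have PF : ProperFilter F.
  by apply: Build_ProperFilter_ex => S FS; apply: contrapT => nS; apply: nGK;
    move: FS; rewrite /F /=; apply: Gsub => x Kx; split=> // Sx; apply: nS; exists x.
have FK : F K by rewrite /F /= setDv.
have [k [Kk /(_ (~` _) _)clk]] := cK F PF FK.
have [V kV GV] := Gloc k Kk.
have := clk V V; case=> // [|x []//].
by rewrite /F /= setDE setCK.
Qed.

(** * Squared Euclidean distance, offsets and insets *)

Definition sqdist (R : realType) (x y : plane R) : R :=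
  (x.1 - y.1) ^+ 2 + (x.2 - y.2) ^+ 2.

Lemma sqdistC (R : realType) (x y : plane R) : sqdist x y = sqdist y x.
Proof. by rewrite /sqdist; ring. Qed.

Lemma sqdist_ge0 (R : realType) (x y : plane R) : 0 <= sqdist x y.
Proof. by rewrite /sqdist addr_ge0 // sqr_ge0. Qed.

Lemma edistance_le (R : realType) (x y : plane R) (s : R) : 0 <= s ->
  (edistance x y <= s) = (sqdist x y <= s ^+ 2).
Proof.
move=> s0; rewrite /edistance -/(sqdist x y).
by rewrite -{1}(ger0_norm s0) -sqrtr_sqr ler_sqrt // sqr_ge0.
Qed.

Lemma offsetP (R : realType) (X : set (plane R)) (s : R) (z : plane R) :
  0 <= s -> offset X s z <-> exists2 x, X x & sqdist z x <= s ^+ 2.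
Proof.
move=> s0; split.
  move=> [x Xx [y]]; rewrite /disk /= edistance_le // => ys <-; exists x => //.
  by move: ys; rewrite /sqdist /= ; congr (_ <= _); ring.
move=> [x Xx zx]; exists x => //; exists (z - x); last by rewrite addrC subrK.
rewrite /disk /= edistance_le //.
by move: zx; rewrite /sqdist /=; congr (_ <= _); ring.
Qed.

Lemma insetP (R : realType) (X : set (plane R)) (s : R) (c : plane R) :
  0 <= s -> inset X s c <-> forall z, sqdist z c <= s ^+ 2 -> X z.
Proof.
move=> s0; rewrite /inset /=; split=> [nO z zc|H].
  by apply: contrapT => nXz; apply: nO; apply/offsetP => //; exists z => //;
    rewrite sqdistC.
by move=> /offsetP -/(_ s0) [z nXz cz]; apply: nXz; apply: H; rewrite sqdistC.
Qed.

Lemma nbhs_boxP (R : realType) (x : plane R) (V : set (plane R)) :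
  nbhs x V <-> exists2 delta : R, 0 < delta & forall y,
    `|x.1 - y.1| < delta -> `|x.2 - y.2| < delta -> V y.
Proof.
split=> [/nbhs_ballP[e e0 eV]|[e e0 eV]].
  by exists e => // y y1 y2; apply: eV; split.
by apply/nbhs_ballP; exists e => // y [y1 y2]; apply: eV.
Qed.

Lemma closed_boxP (R : realType) (X : set (plane R)) (x : plane R) :
  closed X ->
  (forall delta : R, 0 < delta -> exists y,
    [/\ X y, `|x.1 - y.1| < delta & `|x.2 - y.2| < delta]) -> X x.
Proof.
move=> cX H; apply: cX => V /nbhs_boxP[e e0 eV].
by have [y [Xy y1 y2]] := H e e0; exists y; split=> //; exact: eV.
Qed.

Lemma closed_bounded_compact (R : realType) (X : set (plane R)) (M : R) :
  closed X -> (forall x, X x -> `|x.1| <= M /\ `|x.2| <= M) -> compact X.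
Proof.
move=> cX bX; apply: (@subclosed_compact _ X (`[-M, M] `*` `[-M, M])) => //.
  by apply: compact_setX; exact: segment_compact.
by move=> x /bX[]; rewrite !ler_norml => x1 x2; split; rewrite /= in_itv.
Qed.

(** * Accumulation of witnesses as a parameter tends to zero *)

(** Plays the role of sequential compactness. Without an accumulation point, every point of [K] has
    a neighbourhood on which [P h] fails for all small [h]; the sets with this property form an
    ideal. *)
Lemma compact_small_parameter (R : realType) (K : set (plane R))
    (P : R -> plane R -> Prop) :
  compact K ->
  (forall delta : R, 0 < delta -> exists (h : R) (k : plane R), [/\ 0 < h < delta, K k & P h k]) ->
  exists2 k0, K k0 & forall delta : R, 0 < delta -> exists (h : R) (k : plane R),
    [/\ 0 < h < delta, `|k0.1 - k.1| < delta, `|k0.2 - k.2| < delta, K k & P h k].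
Proof.
move=> cK KP; apply: contrapT => nk0.
pose G (A : set (plane R)) := exists2 delta : R, 0 < delta &
  forall h k, 0 < h < delta -> A k -> ~ P h k.
suff [d d0 dG] : G K.
  by have [h [k [hd Kk Phk]]] := KP d d0; exact: dG hd Kk Phk.
apply: compact_ideal_local => //.
- by exists 1.
- by move=> A B AB [d d0 dB]; exists d => // h k hd /AB; exact: dB.
- move=> A B [d d0 dA] [e e0 eB]; exists (Num.min d e); first by rewrite lt_min d0.
  move=> h k /andP[h0]; rewrite lt_min => /andP[hd he] [Ak|Bk].
    by apply: dA; rewrite ?h0.
  by apply: eB; rewrite ?h0.
move=> k Kk; apply: contrapT => nV; apply: nk0; exists k => // d d0.
apply: contrapT => nd; apply: nV.
exists [set y | `|k.1 - y.1| < d /\ `|k.2 - y.2| < d].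
  by apply/nbhs_boxP; exists d.
exists d => // h y hd [Ky [y1 y2]] Phy; apply: nd; exists h, y; split => //.
Qed.

(** Inside a box around [q] the set is a cone with apex [q]. Membership of [q] is left open, so that
    finite unions inherit the property. *)
Definition locally_conic (R : realType) (Q : set (plane R)) (q : plane R) :=
  exists2 rho : R, 0 < rho & forall a b t : R, `|a| < rho -> `|b| < rho -> 0 < t <= 1 ->
    Q (q.1 + a, q.2 + b) <-> Q (q.1 + t * a, q.2 + t * b).

(* [covers Q e] is [offset Q e] and [fits Q e r] is [inset (offset Q e) r]. *)
Definition covers (R : realType) (Q : set (plane R)) (e : R) (z : plane R) :=
  exists2 q, Q q & sqdist z q <= e ^+ 2.

Definition fits (R : realType) (Q : set (plane R)) (e r : R) (c : plane R) :=
  forall z, sqdist z c <= r ^+ 2 -> covers Q e z.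

Lemma sqdist_le_box (R : realType) (x y : plane R) (s : R) : 0 <= s ->
  sqdist x y <= s ^+ 2 -> `|x.1 - y.1| <= s /\ `|x.2 - y.2| <= s.
Proof.
rewrite /sqdist => s0 H; have := sqr_ge0 (x.1 - y.1); have := sqr_ge0 (x.2 - y.2).
by move=> h1 h2; split; rewrite -ler_sqr ?nnegrE // real_normK ?num_real //; lra.
Qed.

Lemma small_positive (R : realType) (a b : R) : 0 < a -> 0 < b ->
  exists h : R, [/\ 0 < h, h < a & h <= b].
Proof.
move=> a0 b0; exists (Num.min (a / 2) b).
by rewrite lt_min b0 gt_min ge_min lexx orbT; split => //; [rewrite divr_gt0|apply/orP; left; lra].
Qed.

Lemma closed_small_parameter (R : realType) (K : set (plane R)) (c : plane R)
    (M : R) (P : R -> plane R -> Prop) :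
  closed K ->
  (forall delta : R, 0 < delta -> exists (h : R) (k : plane R),
     [/\ 0 < h < delta, K k, `|c.1 - k.1| <= M, `|c.2 - k.2| <= M & P h k]) ->
  exists2 k0, K k0 & forall delta : R, 0 < delta -> exists (h : R) (k : plane R),
    [/\ 0 < h < delta, `|k0.1 - k.1| < delta, `|k0.2 - k.2| < delta, K k & P h k].
Proof.
move=> cK H.
pose B := `[c.1 - M, c.1 + M] `*` `[c.2 - M, c.2 + M].
have cBK : compact (B `&` K).
  by apply: compact_closedI => //; apply: compact_setX; exact: segment_compact.
have [d d0|k0 [_ Kk0] k0P] := @compact_small_parameter _ _ P cBK.
  have [h [k [hd Kk k1 k2 Phk]]] := H d d0; exists h, k; split => //; split => //.
  move: k1 k2; rewrite !ler_norml => /andP[? ?] /andP[? ?].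
  by split; rewrite /= in_itv /=; apply/andP; split; lra.
exists k0 => // d d0; have [h [k [hd k1 k2 [_ Kk] Phk]]] := k0P d d0.
by exists h, k.
Qed.

Lemma sqdist_limit (R : realType) (x y : plane R) (s : R) :
  (forall delta : R, 0 < delta -> exists x' y',
    [/\ `|x.1 - x'.1| < delta, `|x.2 - x'.2| < delta,
        `|y.1 - y'.1| < delta, `|y.2 - y'.2| < delta & sqdist x' y' <= s]) ->
  sqdist x y <= s.
Proof.
move=> H; rewrite leNgt; apply/negP => sxy.
pose a := `|x.1 - y.1|; pose b := `|x.2 - y.2|.
have a0 : 0 <= a := normr_ge0 _; have b0 : 0 <= b := normr_ge0 _.
(* Moving all four coordinates by less than [d] lowers the squared distance by at most
   [4 * d * (a + b)], which is less than its excess over [s]. *)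
pose d := (sqdist x y - s) / (8 * (a + b + 1)).
have d0 : 0 < d by rewrite divr_gt0 ?subr_gt0 //; lra.
have [x' [y' [x1 x2 y1 y2]]] := H d d0.
have dE : d * (8 * (a + b + 1)) = sqdist x y - s by rewrite divfK //; lra.
have sq_lower (u v w : R) : `|u - v| < 2 * d -> w = `|u| -> u ^+ 2 - 4 * d * w <= v ^+ 2.
  move=> uv ->; have : u * (u - v) <= `|u| * (2 * d).
    by apply: le_trans (ler_norm _) _; rewrite normrM ler_wpM2l // ltW.
  by have := sqr_ge0 (u - v); nra.
have tri (u v u' v' : R) : `|u - u'| < d -> `|v - v'| < d ->
    `|(u - v) - (u' - v')| < 2 * d.
  by rewrite !ltr_norml => /andP[? ?] /andP[? ?]; apply/andP; split; lra.
have := sq_lower _ _ a (tri _ _ _ _ x1 y1) erefl.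
have := sq_lower _ _ b (tri _ _ _ _ x2 y2) erefl.
move: dE; rewrite /sqdist; nra.
Qed.

(** The Minkowski sum of a closed set and a disk is closed: the points of [Q] that cover the
    approximants stay bounded, hence accumulate in [Q]. *)
Lemma covers_limit (R : realType) (Q : set (plane R)) (e : R) (z : plane R) :
  closed Q -> 0 <= e ->
  (forall delta : R, 0 < delta -> exists y,
    [/\ covers Q e y, `|z.1 - y.1| < delta & `|z.2 - y.2| < delta]) ->
  covers Q e z.
Proof.
move=> cQ e0 H.
pose P h k := exists y, [/\ `|z.1 - y.1| < h, `|z.2 - y.2| < h & sqdist y k <= e ^+ 2].
have [d d0|q Qq qP] := @closed_small_parameter _ Q z (1 + e) P cQ.
  have [h [h0 hd h1]] := small_positive d0 ltr01.
  have [y [[q Qq yq] y1 y2]] := H h h0; exists h, q.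
  have [q1 q2] := sqdist_le_box e0 yq.
  split => //; rewrite ?h0 //; last by exists y.
  - move: y1 q1; rewrite !ltr_norml !ler_norml => /andP[? ?] /andP[? ?].
    by apply/andP; split; lra.
  - move: y2 q2; rewrite !ltr_norml !ler_norml => /andP[? ?] /andP[? ?].
    by apply/andP; split; lra.
exists q => //; apply: sqdist_limit => d d0.
have [h [k [/andP[h0 hd] k1 k2 Kk [y [y1 y2 yk]]]]] := qP d d0.
by exists y, k; split => //; [apply: lt_trans hd|apply: lt_trans hd].
Qed.

Lemma fits_limit (R : realType) (Q : set (plane R)) (e r : R) (c : plane R) :
  closed Q -> 0 <= e ->
  (forall delta : R, 0 < delta -> exists c',
    [/\ fits Q e r c', `|c.1 - c'.1| < delta & `|c.2 - c'.2| < delta]) ->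
  fits Q e r c.
Proof.
move=> cQ e0 H z zc; apply: covers_limit => // d d0.
have [c' [fc' c1 c2]] := H d d0.
exists (z.1 + c'.1 - c.1, z.2 + c'.2 - c.2); split => /=.
- by apply: fc'; move: zc; rewrite /sqdist /=; congr (_ <= _); ring.
- by move: c1; congr (`|_| < _); ring.
- by move: c2; congr (`|_| < _); ring.
Qed.

(** * Tangency, and slack in the covering distance *)

Lemma le0_of_scaled_le (R : realType) (k N : R) : 0 <= N ->
  (forall t, 0 < t <= 1 -> k <= t * N) -> k <= 0.
Proof.
move=> N0 H; rewrite leNgt; apply/negP => k0.
have D0 : 0 < 2 * N + k by lra.
have : k <= k / (2 * N + k) * N.
  by apply: H; rewrite divr_gt0 //= ler_pdivrMr // mul1r; lra.
by rewrite mulrAC ler_pdivlMr //; nra.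
Qed.

(** Moving from [q] along a ray of the cone cannot bring a point closer to [m]. The inequality of
    squared distances, divided by [t], gives the claim as [t] tends to zero. *)
Lemma locally_conic_tangent (R : realType) (Q : set (plane R)) (q m : plane R)
    (rho a b : R) :
  (forall a b t, `|a| < rho -> `|b| < rho -> 0 < t <= 1 ->
    Q (q.1 + a, q.2 + b) <-> Q (q.1 + t * a, q.2 + t * b)) ->
  (forall x, Q x -> sqdist m q <= sqdist m x) ->
  `|a| < rho -> `|b| < rho -> Q (q.1 + a, q.2 + b) ->
  (m.1 - q.1) * a + (m.2 - q.2) * b <= 0.
Proof.
move=> conic out arho brho Qab.
suff : 2 * ((m.1 - q.1) * a + (m.2 - q.2) * b) <= 0 by lra.
apply: (@le0_of_scaled_le _ _ (a ^+ 2 + b ^+ 2)) => [|t t01].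
  by rewrite addr_ge0 ?sqr_ge0.
have /out := (conic a b t arho brho t01).1 Qab.
move: t01 => /andP[t0 _]; rewrite /sqdist /= => H.
by rewrite -(ler_pM2l t0); lra.
Qed.

Lemma covers_near_gap (R : realType) (Q : set (plane R)) (e : R) (m q : plane R) :
  0 < e -> Q q -> sqdist m q < e ^+ 2 ->
  exists2 t : R, 0 < t & forall z,
    `|z.1 - m.1| <= t -> `|z.2 - m.2| <= t -> covers Q e z.
Proof.
(* A shift by at most [t] in each coordinate raises the squared distance by at most
   [4 * t * e + 2 * t ^+ 2], hence by at most [6 * t * e] if [t <= e]. The choice [t = g / (6 * e)]
   uses up the slack [g]. *)
move=> e0 Qq mq; pose g := e ^+ 2 - sqdist m q.
have gE : g / (6 * e) * (6 * e) = g by rewrite divfK //; lra.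
have t0 : 0 < g / (6 * e) by rewrite divr_gt0 ?subr_gt0 //; lra.
exists (g / (6 * e)) => // -[z1 z2] /= h1 h2; exists q => //.
have [m1 m2] := sqdist_le_box (ltW e0) (ltW mq).
have sq_upper (u v t : R) : `|u| <= e -> `|v| <= t -> 0 < t ->
    (u + v) ^+ 2 <= u ^+ 2 + 2 * t * e + t ^+ 2.
  move=> ue vt t_gt0.
  have : u * v <= e * t.
    by apply: le_trans (ler_norm _) _; rewrite normrM; apply: ler_pM.
  have : v ^+ 2 <= t ^+ 2 by rewrite -real_normK ?num_real // ler_sqr ?nnegrE // ltW.
  by nra.
have := sq_upper _ _ _ m1 h1 t0; have := sq_upper _ _ _ m2 h2 t0.
have te : g / (6 * e) <= e.
  rewrite ler_pdivrMr; last by lra.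
  by have := sqdist_ge0 m q; rewrite /g; nra.
move: gE te t0; rewrite /g /sqdist /=; set t := _ / _.
rewrite (_ : m.1 - q.1 + (z1 - m.1) = z1 - q.1); last by ring.
rewrite (_ : m.2 - q.2 + (z2 - m.2) = z2 - q.2); last by ring.
nra.
Qed.

(** * Plane geometry in normalized position *)

(** For a box point outside the disk of radius [r], the drop [r - Y] is at most [X ^+ 2 / r]. Moving
    from [(0, r)] to it changes the squared distance to [q] by at most [4 * X ^+ 2 - 2 * q.1 * X],
    which is not positive in the box. *)
Lemma covers_right_of_touching_disk (R : realType) (Q : set (plane R))
    (e r : R) (q : plane R) :
  0 < e < r -> fits Q e r (0, 0) -> Q q -> sqdist (0, r) q = e ^+ 2 -> 0 < q.1 ->
  forall X Y : R, 0 <= X <= q.1 / 2 -> r - q.1 / 2 <= Y <= r -> covers Q e (X, Y).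
Proof.
move=> /andP[e0 er] f0 Qq mq q0 X Y /andP[X0 Xq] /andP[Yq Yr].
have [in0|out0] := leP (sqdist (X, Y) (0, 0)) (r ^+ 2); first exact: f0.
exists q => //; case: q Qq mq q0 Xq Yq => a b Qq; rewrite /sqdist /= => mq a0 Xa Ya.
have [|h1 h2] := @sqdist_le_box _ (0, r) (a, b) e (ltW e0).
  by rewrite /sqdist /= mq.
move: h1 h2; rewrite /= !ler_norml => /andP[? ?] /andP[? ?].
move: out0; rewrite /sqdist /= !subr0 => out0.
have k0 : 0 <= r - Y by lra.
have kX : (r - Y) * r <= X ^+ 2 by nra.
have kX1 : r - Y <= X by nra.
have ke : (r - Y) * (b - r) <= X ^+ 2.
  by apply: le_trans kX; rewrite ler_wpM2l //; lra.
have kk : (r - Y) ^+ 2 <= X ^+ 2 by rewrite ler_sqr ?nnegrE //; lra.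
by nra.
Qed.

(* The parabola [Y = r - X^2 / (r + e)] has curvature [2 / (r + e)] at its
   vertex, strictly between those of the circles of radii [r] and [e]. *)
Lemma parabola_in_disk (R : realType) (e r h : R) :
  0 < e < r -> 0 < h <= r - e ->
  sqdist (h, r - h ^+ 2 / (r + e)) (0, 0) <= r ^+ 2.
Proof.
move=> /andP[e0 er] /andP[h0 hr]; rewrite /sqdist /= !subr0.
have s0 : 0 < r + e by lra.
set v := h ^+ 2 / (r + e).
have vE : v * (r + e) = h ^+ 2 by rewrite divfK //; lra.
have v0 : 0 <= v by rewrite divr_ge0 ?sqr_ge0 // ltW.
have vr : v <= r - e by rewrite ler_pdivrMr //; nra.
by rewrite -vE; nra.
Qed.

(** The parabola bends less than a circle of radius [e]. A disk of that radius that reaches it at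
    abscissa [h], without the vertex in its interior, has its center to the right by an amount
    proportional to [h]. *)
Lemma parabola_cover_right (R : realType) (e r h : R) (k : plane R) :
  0 < e < r -> 0 < h <= (r - e) / 2 ->
  e ^+ 2 <= sqdist (0, r) k ->
  sqdist (h, r - h ^+ 2 / (r + e)) k <= e ^+ 2 ->
  [/\ (r - e) * h <= 4 * (r + e) * k.1, k.2 <= r + e - h ^+ 2 / (r + e) &
      r - e - h ^+ 2 / (r + e) <= k.2].
Proof.
move=> /andP[e0 er] /andP[h0 hr] out cov.
have [_ /=] := sqdist_le_box (ltW e0) cov.
move: out cov; rewrite /sqdist; case: k => A B /=.
have s0 : 0 < r + e by lra.
set v := h ^+ 2 / (r + e) => out cov.
have vE : v * (r + e) = h ^+ 2 by rewrite divfK //; lra.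
have v0 : 0 <= v by rewrite divr_ge0 ?sqr_ge0 // ltW.
rewrite ler_norml => /andP[h1 h2].
split; [|lra|lra].
have vr : 2 * v <= r - e by rewrite mulrC -ler_pdivlMr // ler_pdivrMr //; nra.
have H1 : h ^+ 2 + 2 * (B - r) * v + v ^+ 2 <= 2 * A * h by nra.
have H2 : - e * v - v ^+ 2 <= (B - r) * v by nra.
have H3 : h ^+ 2 - 2 * e * v - v ^+ 2 <= 2 * A * h by lra.
have H4 : (r + e) * (h ^+ 2 - 2 * e * v - v ^+ 2) =
  h ^+ 2 * (r - e) - v * h ^+ 2 by rewrite -vE; ring.
have H5 : h * ((r - e) * h) <= h * (4 * (r + e) * A) by nra.
by rewrite ler_pM2l in H5.
Qed.

(** Unless a point of [Q] is closer than [e] to the top [(0, r)], or at distance [e] on its right,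
    the points of [Q] covering the parabola accumulate straight above or below the top. The cone
    condition rules out the first and in the second puts a horizontal segment into [Q]. *)
Lemma covers_right_of_top (R : realType) (Q : set (plane R)) (e r : R) :
  0 < e < r -> closed Q -> (forall q, Q q -> locally_conic Q q) ->
  fits Q e r (0, 0) ->
  exists2 t : R, 0 < t & forall X Y : R, 0 <= X <= t -> r - t <= Y <= r ->
    covers Q e (X, Y).
Proof.
move=> er cQ conic f0; have /andP[e0 er'] := er.
have [[q Qq mq]|/forall2NP out] := pselect (exists2 q, Q q & sqdist (0, r) q < e ^+ 2).
  have [t t0 tP] := covers_near_gap e0 Qq mq; exists t => // X Y /andP[X0 Xt] /andP[Yt Yr].
  by apply: tP; rewrite /= ler_norml; apply/andP; split; lra.
have {}out q : Q q -> e ^+ 2 <= sqdist (0, r) q.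
  by move=> Qq; case: (out q) => // /negP; rewrite -leNgt.
have [[q [Qq mq q0]]|noright] :=
    pselect (exists q, [/\ Q q, sqdist (0, r) q = e ^+ 2 & 0 < q.1]).
  exists (q.1 / 2); first by lra.
  by apply: covers_right_of_touching_disk.
pose P (h : R) k := sqdist (h, r - h ^+ 2 / (r + e)) k <= e ^+ 2.
have [d d0|q' Qq' q'P] := @closed_small_parameter _ Q (0, r) (r + 3 * e) P cQ.
  have [|h [h0 hd hr]] := @small_positive _ d ((r - e) / 2) d0; first by lra.
  have [|k Qk kP] := f0 _ (@parabola_in_disk _ e r h er _); first by apply/andP; split; lra.
  exists h, k; have [h1 h2] := sqdist_le_box (ltW e0) kP.
  have [|_ h3 h4] := parabola_cover_right er _ (out _ Qk) kP; first by rewrite h0.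
  have : 0 <= h ^+ 2 / (r + e) <= r.
    by rewrite divr_ge0 ?sqr_ge0 //=; [rewrite ler_pdivrMr; nra|lra].
  move: h1 h2 => /=; rewrite !ler_norml => /andP[? ?] /andP[? ?] /andP[? ?].
  by split => //; rewrite ?h0 //=; apply/andP; split; lra.
have right h k : 0 < h <= (r - e) / 2 -> Q k -> P h k ->
   [/\ (r - e) * h <= 4 * (r + e) * k.1, k.2 <= r + e - h ^+ 2 / (r + e) &
      r - e - h ^+ 2 / (r + e) <= k.2].
  by move=> h0 Qk Phk; exact: parabola_cover_right (out _ Qk) Phk.
have q'e : sqdist (0, r) q' = e ^+ 2.
  apply/eqP; rewrite eq_le out // andbT; apply: sqdist_limit => d d0.
  (* From [h < 1] and [h < d * (r + e)] follows [h ^+ 2 / (r + e) < d]. *)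
  pose d' := Num.min (d * (r + e)) (Num.min d 1).
  have [] := q'P d'; first by rewrite !lt_min d0 ltr01 !andbT mulr_gt0 //; lra.
  move=> h [k [/andP[h0]]]; rewrite !lt_min => /and3P[hd1 hd2 hd3].
  move=> /and3P[_ k1 _] /and3P[_ k2 _] Qk Phk.
  exists (h, r - h ^+ 2 / (r + e)), k; split => //=.
    by rewrite sub0r normrN gtr0_norm.
  rewrite opprB addrC subrK ger0_norm; last by rewrite divr_ge0 ?sqr_ge0 //; lra.
  by rewrite ltr_pdivrMr; [nra|lra].
have q'1_le0 : q'.1 <= 0.
  by rewrite leNgt; apply/negP => q'0; apply: noright; exists q'.
have q'1_ge0 : 0 <= q'.1.
  rewrite leNgt; apply/negP => q'0.
  pose d := Num.min (- q'.1) ((r - e) / 2).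
  have [|h [k [/andP[h0]]]] := q'P d; first by rewrite lt_min; apply/andP; split; lra.
  rewrite !lt_min => /andP[_ hr] /andP[+ _] _ Qk Phk.
  have [|k1 _ _] := right h k _ Qk Phk; first by apply/andP; split; lra.
  by rewrite ltr_norml => /andP[? ?]; nra.
have [q'1 q'2] : q'.1 = 0 /\ (q'.2 = r + e \/ q'.2 = r - e).
  split; first by lra.
  move: q'e; rewrite /sqdist /= (_ : q'.1 = 0); last by lra.
  rewrite subrr expr0n add0r => /eqP; rewrite eqf_sqr => /orP[/eqP ?|/eqP ?]; [right|left]; lra.
have [rho rho0 cone] := conic q' Qq'.
have tangent a b : `|a| < rho -> `|b| < rho -> Q (q'.1 + a, q'.2 + b) ->
    (r - q'.2) * b <= 0.
  move=> ha hb Qab; have := locally_conic_tangent (m := (0, r)) cone _ ha hb Qab.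
  by rewrite /= q'1 subrr mul0r add0r; apply=> x /out; rewrite q'e.
have shape (k : plane R) : k = (q'.1 + (k.1 - q'.1), q'.2 + (k.2 - q'.2)).
  by case: k => ? ? /=; congr pair; ring.
case: q'2 => q'2.
  (* Tangency keeps [k] at height at least [r + e], while [parabola_cover_right] puts it strictly
     lower. *)
  exfalso; pose d := Num.min rho ((r - e) / 2).
  have [|h [k [/andP[h0]]]] := q'P d; first by rewrite lt_min rho0; lra.
  rewrite !lt_min => /andP[_ hr] /andP[k1 _] /andP[k2 _] Qk Phk.
  have [|_ kv _] := right h k _ Qk Phk; first by apply/andP; split; lra.
  have v0 : 0 < h ^+ 2 / (r + e) by rewrite divr_gt0 ?exprn_gt0 //; lra.
  have := tangent (k.1 - q'.1) (k.2 - q'.2).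
  rewrite -shape distrC (distrC k.2) => /(_ k1 k2 Qk); rewrite q'2.
  have : 0 < e * (r + e - k.2) by rewrite mulr_gt0 //; lra.
  by lra.
have Qline T : 0 <= T < rho -> Q (T, r - e).
  move=> /andP[]; rewrite le_eqVlt => /predU1P[<- _|T0 Trho].
    by move: Qq'; rewrite (surjective_pairing q') q'1 q'2.
  apply: closed_boxP => // d d0.
  (* The ray from [q'] through [k] has slope at most [4 * h / (r - e)] in absolute value. The last
     bound on [h] keeps its change of height up to abscissa [T] below [d] and [rho]. *)
  pose d' := Num.min (Num.min T rho) (Num.min ((r - e) / 2)
    (Num.min d rho * (r - e) / (4 * T))).
  have [|h [k [/andP[h0]]]] := q'P d'.
    rewrite !lt_min T0 rho0 /=; apply/andP; split; first by lra.
    by rewrite divr_gt0 ?mulr_gt0 ?lt_min ?d0 ?rho0 //; lra.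
  rewrite !lt_min => /and3P[/andP[_ hrho] hr hd] /andP[/andP[kT k1] _] /andP[/andP[_ k2] _] Qk Phk.
  have [|kA _ kv] := right h k _ Qk Phk; first by apply/andP; split; lra.
  have := tangent (k.1 - q'.1) (k.2 - q'.2).
  rewrite -shape distrC (distrC k.2) => /(_ k1 k2 Qk) kneg.
  move: kT k1 k2 kneg (shape k); rewrite q'1 q'2 sub0r subr0 normrN add0r => kT k1 k2 kneg.
  set b := k.2 - (r - e); rewrite -/b in kneg => kE.
  have s0 : 0 < r + e by lra.
  have A0 : 0 < k.1 by nra.
  have b0 : b <= 0 by move: kneg; rewrite opprB addrCA subrr addr0; nra.
  have bv : - (h ^+ 2 / (r + e)) <= b by rewrite /b; lra.
  have AT : k.1 < T by move: kT; rewrite gtr0_norm.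
  have bd : `|T / k.1 * b| < Num.min d rho.
    rewrite ler0_norm; last by rewrite mulr_ge0_le0 // divr_ge0 // ltW.
    move: hd; rewrite ltr_pdivlMr; last by lra.
    set D := Num.min d rho => hd.
    rewrite -mulrN mulrAC ltr_pdivrMr //.
    have : - b * (r + e) <= h ^+ 2 by rewrite -ler_pdivlMr //; lra.
    move=> hb.
    have : T * - b * (4 * (r + e)) < D * k.1 * (4 * (r + e)).
      have : T * - b * (4 * (r + e)) <= h * (h * (4 * T)) by nra.
      have : h * (h * (4 * T)) < h * (D * (r - e)) by rewrite ltr_pM2l.
      have D0 : 0 < D by rewrite lt_min d0.
      have : D * ((r - e) * h) <= D * (4 * (r + e) * k.1) by rewrite ler_pM2l.
      lra.
    by rewrite ltr_pM2r //; lra.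
  move: bd; rewrite lt_min => /andP[bd brho].
  exists (T, r - e + T / k.1 * b); split => /=.
  - have := cone T (T / k.1 * b) (k.1 / T).
    rewrite q'1 q'2 !add0r => H; apply/H => //.
    + by rewrite gtr0_norm.
    + by rewrite divr_gt0 //= ler_pdivrMr // mul1r ltW.
    + rewrite divfK ?gt_eqF // (_ : k.1 / T * (T / k.1 * b) = b); first by rewrite -kE.
      by field; rewrite !gt_eqF.
  - by rewrite subrr normr0.
  - by rewrite opprD addrA subrr sub0r normrN.
exists (Num.min (rho / 2) e); first by rewrite lt_min e0 andbT; lra.
move=> X Y; rewrite le_min => /and3P[X0 Xrho Xe] /andP[Ye Yr].
have {}Ye : r - e <= Y by apply: le_trans Ye; rewrite lerD2l lerN2 ge_min lexx orbT.
exists (X, r - e); first by apply: Qline; apply/andP; split; lra.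
by rewrite /sqdist /=; nra.
Qed.

(* [(k x, h)] lies on a parabola of curvature [1 / rho], [r < rho < r + e], through
   the origin.  [rho > r] keeps the new part of its disk to the right of the
   vertical axis; [rho < r + e] brings it closer to [(0, r + e)] than the origin.
   The margin [D = 1 / rho - 1 / s] pays for the height of [(x, y)], which is
   about [x^2 / (2 s)] at most, and [mu] is small compared to it so that the two
   disks of radius [r] cover the bottom. *)
Lemma lune_in_top_box (R : realType) (r e t rho s D mu k x y h X Y : R) :
  0 < e < r -> 0 < t <= r ->
  rho = r + e / 2 -> s = r + e -> 0 < D -> s = rho + D * rho * s ->
  mu = r * D / 8 -> k = 1 - mu -> mu < 1 ->
  0 < x -> x <= e / 2 -> (2 * mu + 1 + 2 * s / r) * x <= 2 * mu * t ->
  (2 * mu + 1 + 2 * s / r) * x <= mu * r ->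
  0 <= y -> y <= x -> y <= D * s ^+ 2 / 4 -> 16 * y <= 3 * r * D * s ->
  2 * y * s <= x ^+ 2 + y ^+ 2 ->
  2 * rho * h = (k * x) ^+ 2 ->
  r ^+ 2 < X ^+ 2 + Y ^+ 2 -> r ^+ 2 < (X - x) ^+ 2 + (Y - y) ^+ 2 ->
  (X - k * x) ^+ 2 + (Y - h) ^+ 2 <= r ^+ 2 ->
  [/\ 0 <= X <= t, r - t <= Y & Y <= r + e].
Proof.
move=> /andP[e0 er] /andP[t0 tr] rhoE sE D0 sD muE kE mu1 x0 xe xt xr.
move=> y0 yx yD yr ys hE out0 outp inc.
have s0 : 0 < s by lra.
have rho0 : 0 < rho by lra.
have mu0 : 0 < mu by rewrite muE; nra.
have k0 : 0 < k by lra.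
have k1 : k < 1 by lra.
have h0 : 0 <= h by have := sqr_ge0 (k * x); nra.
have kx0 : 0 < k * x by rewrite mulr_gt0.
have kxx : k * x <= x by rewrite ler_piMl // ltW.
have kx : (k * x) ^+ 2 <= x ^+ 2 by rewrite ler_sqr ?nnegrE // ltW.
have hx : 2 * h * r <= x ^+ 2 by nra.
have he : h <= e / 2 by nra.
have r0 : 0 < r by lra.
have /andP[Yge Yle] : - r <= Y - h <= r.
  rewrite -ler_norml -ler_sqr ?nnegrE ?(ltW r0) // real_normK ?num_real //.
  by have := sqr_ge0 (X - k * x); lra.
(* The point is closer to [(k * x, h)] than to the old centers: the origin in [half1], and [(x, y)]
   in [half2]. *)
have half1 : (k * x) ^+ 2 + h ^+ 2 < 2 * (k * x) * X + 2 * h * Y by lra.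
have half2 : 2 * mu * x * X < (1 - k ^+ 2) * x ^+ 2 + y ^+ 2 - h ^+ 2 + 2 * Y * (h - y).
  by rewrite kE in inc *; lra.
have X0 : 0 <= X.
  rewrite leNgt; apply/negP => Xlt0.
  have : 2 * h * Y <= 2 * h * rho by nra.
  have : k * x * X < 0 by rewrite pmulr_rlt0 // mulr_gt0.
  have := sqr_ge0 h.
  by lra.
have ysx : y * s <= x ^+ 2 by nra.
have ysq : y ^+ 2 * s <= y * x ^+ 2 by nra.
(* This bounds the right side of [half2] by a multiple of [x ^+ 2], so that [X] is at most of order
   [x / mu]. *)
have lune_width : 2 * Y * (h - y) <= 2 * s / r * x ^+ 2.
  rewrite [leRHS]mulrAC ler_pdivlMr //.
  have [yh|hy] := leP y h.
    have : Y * (h - y) <= s * h by nra.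
    have : s * (2 * h * r) <= s * x ^+ 2 by rewrite ler_pM2l.
    have : 0 <= s * x ^+ 2 by rewrite mulr_ge0 ?sqr_ge0 // ltW.
    by nra.
  have Yy : Y * (h - y) <= r * y by nra.
  have : Y * (h - y) * r <= r * y * r by rewrite ler_wpM2r // ltW.
  have : y * (r * r) <= y * (s * s) by rewrite ler_wpM2l //; nra.
  have : y * s * s <= x ^+ 2 * s by rewrite ler_wpM2r // ltW.
  by lra.
have Xub : 2 * mu * X < (2 * mu + 1 + 2 * s / r) * x.
  rewrite -(ltr_pM2l x0).
  have : (1 - k ^+ 2) * x ^+ 2 <= 2 * mu * x ^+ 2.
    by rewrite ler_wpM2r ?sqr_ge0 // kE; have := sqr_ge0 mu; lra.
  have : y ^+ 2 <= x ^+ 2 by rewrite ler_sqr ?nnegrE // ltW.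
  by have := sqr_ge0 h; lra.
have Xt : X < t by rewrite -(ltr_pM2l mu0); lra.
have Xr : X < r / 2 by rewrite -(ltr_pM2l mu0); lra.
have Yr2 : - (r / 2) < Y.
  rewrite ltNge; apply/negP => Yneg.
  have x20 : 0 < x ^+ 2 by rewrite exprn_gt0.
  (* In the sum of [mu] times [half1] and [k] times [half2] the terms in [X] cancel. *)
  have combined : - (k * mu) * x ^+ 2 - k * y ^+ 2 < 2 * Y * (h - k * y).
    have : mu * ((k * x) ^+ 2 + h ^+ 2) < mu * (2 * (k * x) * X + 2 * h * Y).
      by rewrite ltr_pM2l.
    have : k * (2 * mu * x * X) < k * ((1 - k ^+ 2) * x ^+ 2 + y ^+ 2 - h ^+ 2 + 2 * Y * (h - y)).
      by rewrite ltr_pM2l.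
    by have := sqr_ge0 h; rewrite (_ : k = 1 - mu) //; nra.
  have y2D : y ^+ 2 <= D * s / 4 * x ^+ 2.
    have : y * x ^+ 2 <= D * s ^+ 2 / 4 * x ^+ 2 by rewrite ler_wpM2r // ltW.
    by move=> ?; rewrite -(ler_pM2l s0); lra.
  have y2r : 16 * y ^+ 2 <= 3 * r * D * x ^+ 2.
    have : 16 * y * x ^+ 2 <= 3 * r * D * s * x ^+ 2 by rewrite ler_wpM2r // ltW.
    by move=> ?; rewrite -(ler_pM2l s0); lra.
  (* Of the margin [D], the factor [k] costs one eighth and the bound on [y] one quarter. *)
  have slope : 5 / 8 * D * rho * x ^+ 2 <= k * x ^+ 2 - 2 * rho * y.
    rewrite -(ler_pM2l s0).
    have : rho * (2 * y * s) <= rho * ((1 + D * s / 4) * x ^+ 2).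
      by rewrite ler_pM2l //; clear - ys y2D; lra.
    have : s * x ^+ 2 = (rho + D * rho * s) * x ^+ 2 by rewrite -sD.
    have : mu * s * x ^+ 2 <= rho * D * s / 8 * x ^+ 2.
      have : r * (D * s) <= rho * (D * s).
        rewrite ler_wpM2r ?mulr_ge0 ?(ltW D0) ?(ltW s0) // rhoE lerDl.
        by clear - e0; lra.
      by move=> Drs; rewrite ler_wpM2r ?sqr_ge0 // muE; clear - Drs; lra.
    by rewrite kE; lra.
  have gE : rho * (2 * (h - k * y)) = k * (k * x ^+ 2 - 2 * rho * y).
    by rewrite mulrBr mulrBr mulrA [rho * 2]mulrC hE; ring.
  have gge : k * (5 / 8 * D * x ^+ 2) <= 2 * (h - k * y).
    rewrite -(ler_pM2l rho0) gE mulrCA ler_pM2l //.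
    by apply: le_trans slope; lra.
  have : Y * (2 * (h - k * y)) <= - (r / 2) * (k * (5 / 8 * D * x ^+ 2)).
    have : 0 <= k * (5 / 8 * D * x ^+ 2).
      by rewrite mulr_ge0 ?(ltW k0) // mulr_ge0 ?(ltW x20) // mulr_ge0 ?(ltW D0) // divr_ge0.
    by clear - Yneg gge r0; nra.
  have : k * (16 * y ^+ 2) <= k * (3 * r * D * x ^+ 2) by rewrite ler_pM2l.
  by move: combined; rewrite {1}muE; lra.
(* With these bounds on [X] and [Y > - (r / 2)], a height below [r - t] would put the point into the
   disk around the origin. *)
split; [by rewrite X0 ltW|rewrite leNgt; apply/negP => Yt|lra].
by clear - X0 Xt Xr Yr2 Yt tr t0 r0 out0; have [Y0|Y0] := leP 0 Y; nra.
Qed.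

(** Given a nearby center [(x, y)], the disk of radius [r] around [((1 - mu) * x, h)] is covered by
    the two given disks, the box at the top and the [e]-neighbourhood of the segment, although its
    center is too close to [(0, r + e)]. *)
Lemma no_tangential_covering (R : realType) (Q : set (plane R)) (e r t0 : R) :
  0 < e < r -> closed Q -> (forall q, Q q -> locally_conic Q q) ->
  0 < t0 -> (forall t, 0 <= t <= t0 -> Q (t, r + e)) ->
  fits Q e r (0, 0) ->
  (forall c, fits Q e r c -> (r + e) ^+ 2 <= sqdist (0, r + e) c) ->
  ~ forall delta : R, 0 < delta -> exists (tau : R) (p : plane R),
    [/\ 0 < tau < delta, `|p.1| < delta, `|p.2| < delta, fits Q e r p &
        sqdist (tau, r + e) p <= (r + e) ^+ 2].
Proof.
move=> er cQ conic t00 Qt f0 far near0; have /andP[e0 er'] := er.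
have [t1 t10 top] := covers_right_of_top er cQ conic f0.
pose t := Num.min t1 (Num.min r t0).
have [tt0 tt1 tr tt] : [/\ 0 < t, t <= t1, t <= r & t <= t0].
  by rewrite /t !lt_min !ge_min !lexx t10 t00 ?orbT; split => //; lra.
pose s := r + e; pose rho := r + e / 2.
have s0 : 0 < s by rewrite /s; lra.
have rho0 : 0 < rho by rewrite /rho; lra.
pose D := e / (2 * rho * s).
have DE : D * (2 * rho * s) = e by rewrite divfK // gt_eqF // !mulr_gt0.
have D0 : 0 < D by rewrite divr_gt0 // !mulr_gt0.
have srho : s = rho + e / 2 by rewrite /s /rho; lra.
have sD : s = rho + D * rho * s by lra.
pose mu := r * D / 8.
have mu0 : 0 < mu by rewrite /mu; nra.
have mu1 : mu < 1.
  have : D * (2 * rho * s) < r by rewrite DE.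
  have : r * r <= rho * s by rewrite /rho /s; nra.
  rewrite /mu; nra.
pose C := 2 * mu + 1 + 2 * s / r.
have C0 : 0 < C.
  have : 0 < s / r by rewrite divr_gt0 //; lra.
  by rewrite /C -mulrA; lra.
have sE : s = r + e by [].
have rhoE : rho = r + e / 2 by [].
have muE : mu = r * D / 8 by [].
have CE : C = 2 * mu + 1 + 2 * s / r by [].
clearbody s rho mu C D.
(* The smallness hypotheses of [lune_in_top_box], solved for [x] and [y]. *)
pose dx := Num.min (e / 2) (Num.min (2 * mu * t / C) (mu * r / C)).
pose dy := Num.min (D * s ^+ 2 / 4) (3 * r * D * s / 16).
have d0 : 0 < Num.min dx dy.
  have r0 : 0 < r by lra.
  by rewrite !lt_min; repeat (apply/andP; split); rewrite ?divr_gt0 ?mulr_gt0 ?exprn_gt0.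
have [tau [[x y] [/andP[tau0 _]]]] := near0 _ d0.
rewrite /= !lt_min => /andP[/and3P[xe xt xr] _] /andP[/and3P[ye _ _] /andP[yD yr]] fp near.
have := far _ fp; move: near; rewrite /sqdist /= -sE => near farp.
(* Together [near] and [farp] give [tau ^+ 2 <= 2 * tau * x]. *)
have x0 : 0 < x by have := sqr_ge0 tau; nra.
move: xe xt xr; rewrite gtr0_norm // => xe; rewrite !ltr_pdivlMr // => xt xr.
move: yD ye; rewrite !ltr_norml => /andP[_ yD] /andP[_ ye].
move: yr; rewrite ltr_norml ltr_pdivlMr // => /andP[_ yr].
have ys : 2 * y * s <= x ^+ 2 + y ^+ 2 by lra.
have y0 : 0 <= y by have := sqr_ge0 (tau - x); nra.
have yx : y <= x by nra.
pose h := ((1 - mu) * x) ^+ 2 / (2 * rho).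
have hE : 2 * rho * h = ((1 - mu) * x) ^+ 2.
  by rewrite mulrC divfK // gt_eqF // mulr_gt0.
have h0 : 0 < h by rewrite divr_gt0 ?exprn_gt0 ?mulr_gt0 //; lra.
have he : h < e.
  have : ((1 - mu) * x) ^+ 2 <= x ^+ 2.
    by rewrite exprMn ler_piMl ?sqr_ge0 // expr_le1 //; lra.
  by rewrite -hE; nra.
(* By [hE], this center is closer than [s] to [(0, s)] as soon as [h < 2 * (s - rho)], and the right
   side is [e]. *)
suff /far : fits Q e r ((1 - mu) * x, h).
  by rewrite /sqdist /= -sE; nra.
move=> [X Y]; rewrite {1}/sqdist /= => inc.
have [in0|out0] := leP (sqdist (X, Y) (0, 0)) (r ^+ 2); first exact: f0.
have [inp|outp] := leP (sqdist (X, Y) (x, y)) (r ^+ 2); first exact: fp.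
have [/andP[X0 Xt] Yt Ye] : [/\ 0 <= X <= t, r - t <= Y & Y <= r + e].
  move: out0 outp; rewrite /sqdist /= !subr0 => out0 outp.
  apply: (@lune_in_top_box _ r e t rho s D mu (1 - mu) x y h X Y) => //.
  - by rewrite tt0.
  - by lra.
  - by rewrite -CE mulrC ltW.
  - by rewrite -CE mulrC ltW.
  - by lra.
  - by lra.
have [Yr|rY] := leP Y r; first by apply: top; clear - X0 Xt Yt Yr tt1; lra.
exists (X, s); first by rewrite sE; apply: Qt; clear - X0 Xt tt; lra.
by rewrite /sqdist /= subrr expr0n add0r; clear - e0 sE rY Ye; nra.
Qed.

(** * Isometric change of coordinates *)

(** Coordinates with origin [p], second axis [u] and first axis [(sg * u.2, - sg * u.1)]. The sign
    [sg] allows both orientations. *)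
Definition frame (R : realType) (p u : plane R) (sg : R) (z : plane R) : plane R :=
  (p.1 + z.1 * (sg * u.2) + z.2 * u.1, p.2 - z.1 * (sg * u.1) + z.2 * u.2).

Definition unframe (R : realType) (p u : plane R) (sg : R) (x : plane R) : plane R :=
  (sg * (u.2 * (x.1 - p.1) - u.1 * (x.2 - p.2)),
   u.1 * (x.1 - p.1) + u.2 * (x.2 - p.2)).

Section Frame.
Context {R : realType} (p u : plane R) (sg : R).
Hypotheses (u1 : u.1 ^+ 2 + u.2 ^+ 2 = 1) (sg1 : sg ^+ 2 = 1).
Local Notation phi := (frame p u sg).
Local Notation psi := (unframe p u sg).

Lemma frameK : cancel psi phi.
Proof.
move=> [x y]; rewrite /frame /unframe /=.
have cancel_sg a b : sg * a * (sg * b) = a * b.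
  by rewrite mulrACA -expr2 sg1 mul1r.
rewrite !cancel_sg; congr pair.
  transitivity (p.1 + (u.1 ^+ 2 + u.2 ^+ 2) * (x - p.1)); first by ring.
  by rewrite u1; ring.
transitivity (p.2 + (u.1 ^+ 2 + u.2 ^+ 2) * (y - p.2)); first by ring.
by rewrite u1; ring.
Qed.

Lemma sqdist_frame z z' : sqdist (phi z) (phi z') = sqdist z z'.
Proof.
rewrite /sqdist /frame /=.
transitivity ((u.1 ^+ 2 + u.2 ^+ 2) *
  (sg ^+ 2 * (z.1 - z'.1) ^+ 2 + (z.2 - z'.2) ^+ 2)); first by ring.
by rewrite u1 sg1; ring.
Qed.

(** The four expressions are the coordinates of the linear parts of [phi] and [psi], whose
    coefficients are at most 1 in absolute value. *)
Lemma frame_coord_bound a b delta : `|a| < delta / 2 -> `|b| < delta / 2 ->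
  [/\ `|a * (sg * u.2) + b * u.1| < delta, `|- a * (sg * u.1) + b * u.2| < delta,
      `|sg * (u.2 * a - u.1 * b)| < delta & `|u.1 * a + u.2 * b| < delta].
Proof.
have sgn : `|sg| = 1.
  by apply/eqP; rewrite -sqrp_eq1 // real_normK ?num_real // sg1.
have v1 : `|u.1| <= 1.
  by rewrite -ler_sqr ?nnegrE // real_normK ?num_real //; move: u1; have := sqr_ge0 u.2; lra.
have v2 : `|u.2| <= 1.
  by rewrite -ler_sqr ?nnegrE // real_normK ?num_real //; move: u1; have := sqr_ge0 u.1; lra.
move=> ha hb.
have bound v w x y : `|v| <= 1 -> `|w| <= 1 -> `|x| < delta / 2 ->
    `|y| < delta / 2 -> `|x * v + y * w| < delta.
  move=> hv hw hx hy; apply: le_lt_trans (ler_normD _ _) _; rewrite !normrM.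
  have : `|x| * `|v| <= `|x| by rewrite ler_piMr.
  have : `|y| * `|w| <= `|y| by rewrite ler_piMr.
  by lra.
split.
- by apply: bound => //; rewrite normrM sgn mul1r.
- by apply: bound => //; rewrite ?normrN // normrM sgn mul1r.
- rewrite normrM sgn mul1r (_ : _ - _ = a * u.2 + b * - u.1); last by ring.
  by apply: bound; rewrite ?normrN.
- by rewrite mulrC [u.2 * b]mulrC; apply: bound.
Qed.

Lemma closed_frame Q : closed Q -> closed (phi @^-1` Q).
Proof.
move=> cQ z clz; apply: (@closed_boxP _ Q (phi z)) => // d d0.
have [|z' [Qz' /= [z1 z2]]] := clz [set z' | `|z.1 - z'.1| < d / 2 /\ `|z.2 - z'.2| < d / 2].
  by apply/nbhs_boxP; exists (d / 2) => //; lra.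
exists (phi z'); have [h1 h2 _ _] := frame_coord_bound z1 z2; split => //.
- by move: h1; congr (`|_| < _); rewrite /frame /=; ring.
- by move: h2; congr (`|_| < _); rewrite /frame /=; ring.
Qed.

Lemma locally_conic_frame Q z :
  locally_conic Q (phi z) -> locally_conic (phi @^-1` Q) z.
Proof.
move=> [rho rho0 cone]; exists (rho / 2) => [|a b t ha hb t01]; first by lra.
have [h1 h2 _ _] := frame_coord_bound ha hb.
have := cone _ _ _ h1 h2 t01.
rewrite /frame /=; set A := (_, _); set B := (_, _) => H.
set A' := (_, _); set B' := (_, _).
have -> : A' = A by rewrite /A /A'; congr pair; ring.
by have -> : B' = B by rewrite /B /B'; congr pair; ring.
Qed.

Lemma covers_frame Q e z : covers (phi @^-1` Q) e z <-> covers Q e (phi z).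
Proof.
split=> [[q Qq zq]|[q Qq zq]].
  by exists (phi q) => //; rewrite sqdist_frame.
by exists (psi q); rewrite /= ?frameK // -sqdist_frame frameK.
Qed.

Lemma fits_frame Q e r c : fits (phi @^-1` Q) e r c <-> fits Q e r (phi c).
Proof.
split=> H z zc.
  by rewrite -[z]frameK; apply/covers_frame/H; rewrite -sqdist_frame frameK.
by apply/covers_frame/H; rewrite sqdist_frame.
Qed.

End Frame.

(** * Centers that cover an initial piece of a ray *)

Lemma closed_fits (R : realType) (Q : set (plane R)) (e r : R) :
  closed Q -> 0 <= e -> closed (fits Q e r).
Proof.
move=> cQ e0 c clc; apply: fits_limit => // d d0.
have [|c' [fc' [h1 h2]]] := clc [set c' | `|c.1 - c'.1| < d /\ `|c.2 - c'.2| < d].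
  by apply/nbhs_boxP; exists d.
by exists c'.
Qed.

(** Otherwise the centers covering [q + h d] accumulate at some [p] with [q - p] orthogonal to [d],
    and a frame at [p] gives the configuration excluded by [no_tangential_covering]. *)
Lemma exists_backward_center (R : realType) (Q : set (plane R)) (e r : R)
    (q d : plane R) :
  0 < e < r -> closed Q -> (forall x, Q x -> locally_conic Q x) ->
  (forall x, Q x -> exists2 c, fits Q e r c & sqdist x c <= (r + e) ^+ 2) ->
  (forall c, fits Q e r c -> (r + e) ^+ 2 <= sqdist q c) ->
  d != (0, 0) -> (forall t, 0 <= t <= 1 -> Q (q.1 + t * d.1, q.2 + t * d.2)) ->
  exists c, [/\ fits Q e r c, sqdist q c <= (r + e) ^+ 2 &
    d.1 * (q.1 - c.1) + d.2 * (q.2 - c.2) < 0].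
Proof.
move=> er cQ conic near far dn0 Qd; have /andP[e0 er'] := er.
apply: contrapT => nback.
have {nback} forward c : fits Q e r c -> sqdist q c <= (r + e) ^+ 2 ->
    0 <= d.1 * (q.1 - c.1) + d.2 * (q.2 - c.2).
  by move=> fc qc; rewrite leNgt; apply/negP => dc; apply: nback; exists c.
have s0 : 0 < r + e by lra.
pose P h c := sqdist (q.1 + h * d.1, q.2 + h * d.2) c <= (r + e) ^+ 2.
have cF : closed (fits Q e r) by apply: closed_fits => //; exact: ltW.
have [delta delta0|p fp pP] :=
    @closed_small_parameter _ _ q (`|d.1| + `|d.2| + (r + e)) P cF.
  have [h [h0 hd h1]] := small_positive delta0 ltr01.
  have [|c fc hc] := near (q.1 + h * d.1, q.2 + h * d.2).
    by apply: Qd; rewrite h1 ltW.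
  exists h, c; have [/= c1 c2] := sqdist_le_box (ltW s0) hc.
  have shift (a b x : R) : `|a + h * b - x| <= r + e -> `|a - x| <= `|b| + (r + e).
    move=> H; rewrite (_ : a - x = - (h * b) + (a + h * b - x)); last by ring.
    apply: le_trans (ler_normD _ _) _; rewrite normrN normrM (gtr0_norm h0).
    have : h * `|b| <= `|b| by rewrite ler_piMl.
    by lra.
  split => //; first by rewrite h0.
  - by have := shift _ _ _ c1; have := normr_ge0 d.2; lra.
  - by have := shift _ _ _ c2; have := normr_ge0 d.1; lra.
have qp : sqdist q p <= (r + e) ^+ 2.
  apply: sqdist_limit => delta delta0.
  pose N := `|d.1| + `|d.2| + 1.
  have [d10 d20] := (normr_ge0 d.1, normr_ge0 d.2).
  have N0 : 0 < N by rewrite /N; lra.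
  have [|h [c [/andP[h0]]]] := pP (Num.min delta (delta / N)).
    by rewrite lt_min delta0 divr_gt0.
  rewrite !lt_min => /andP[_]; rewrite ltr_pdivlMr // => hN /andP[c1 _] /andP[c2 _] fc hc.
  exists (q.1 + h * d.1, q.2 + h * d.2), c; split => //=.
  - by rewrite opprD addrA subrr sub0r normrN normrM gtr0_norm //; rewrite /N in hN; nra.
  - by rewrite opprD addrA subrr sub0r normrN normrM gtr0_norm //; rewrite /N in hN; nra.
(* A center [c] that covers [q + h d] and is at least [r + e] away from [q] satisfies
   [2 h <d, q - c> + h^2 |d|^2 <= 0]. The sign of the scalar product passes to the limit. *)
have back : d.1 * (q.1 - p.1) + d.2 * (q.2 - p.2) <= 0.
  rewrite leNgt; apply/negP => g0.
  set g := _ + _ in g0.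
  have [d10 d20] := (normr_ge0 d.1, normr_ge0 d.2).
  have N0 : 0 < `|d.1| + `|d.2| + 1 by lra.
  have [|h [c [/andP[h0 _] c1 c2 fc hc]]] := pP (g / (`|d.1| + `|d.2| + 1)).
    by rewrite divr_gt0.
  have := far c fc; move: hc c1 c2; rewrite /P /sqdist /= !ltr_pdivlMr // => hc c1 c2 qc.
  have lower (a x : R) : a * x <= `|a| * `|x| by rewrite -normrM ler_norm.
  have := lower (- d.1) (p.1 - c.1); have := lower (- d.2) (p.2 - c.2).
  rewrite !normrN => l1 l2.
  have : 0 <= h * (d.1 ^+ 2 + d.2 ^+ 2).
    by rewrite mulr_ge0 ?addr_ge0 ?sqr_ge0 // ltW.
  have back' : d.1 * (q.1 - c.1) + d.2 * (q.2 - c.2) <= 0.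
    rewrite -(ler_pM2l h0) mulr0; have := sqr_ge0 (h * d.1); have := sqr_ge0 (h * d.2).
    by nra.
  by have := normr_ge0 (p.1 - c.1); have := normr_ge0 (p.2 - c.2); rewrite /g in c1 c2 *; nra.
have perp : d.1 * (q.1 - p.1) + d.2 * (q.2 - p.2) = 0.
  by apply/eqP; rewrite eq_le back forward.
have qpE : sqdist q p = (r + e) ^+ 2 by apply/eqP; rewrite eq_le qp far.
clear back qp.
pose u : plane R := ((q.1 - p.1) / (r + e), (q.2 - p.2) / (r + e)).
have uE : (r + e) * u.1 = q.1 - p.1 /\ (r + e) * u.2 = q.2 - p.2.
  by rewrite /u /= ![(r + e) * _]mulrC !divfK // gt_eqF.
have u1 : u.1 ^+ 2 + u.2 ^+ 2 = 1.
  apply: (mulfI (x := (r + e) ^+ 2)); first by rewrite expf_neq0 // gt_eqF.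
  by rewrite mulr1 mulrDr -!exprMn uE.1 uE.2 -qpE.
clearbody u.
pose l := d.1 * u.2 - d.2 * u.1.
have du : d.1 * u.1 + d.2 * u.2 = 0.
  by apply: (mulfI (x := r + e)); rewrite ?gt_eqF // mulr0 -[RHS]perp -uE.1 -uE.2; ring.
have dE : d.1 = l * u.2 /\ d.2 = - l * u.1.
  split.
    transitivity (d.1 * (u.1 ^+ 2 + u.2 ^+ 2)); first by rewrite u1 mulr1.
    transitivity (l * u.2 + u.1 * (d.1 * u.1 + d.2 * u.2)); first by rewrite /l; ring.
    by rewrite du mulr0 addr0.
  transitivity (d.2 * (u.1 ^+ 2 + u.2 ^+ 2)); first by rewrite u1 mulr1.
  transitivity (- l * u.1 + u.2 * (d.1 * u.1 + d.2 * u.2)); first by rewrite /l; ring.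
  by rewrite du mulr0 addr0.
have l0 : l != 0.
  apply: contra_neq dn0 => l0; rewrite (surjective_pairing d) dE.1 dE.2 l0.
  by rewrite oppr0 !mul0r.
(* With this sign the first axis of the frame points along [d], and [L] is the length of [d]. *)
pose sg := Num.sg l; pose L := `|l|.
have L0 : 0 < L by rewrite normr_gt0.
have sgL : sg * L = l by rewrite /sg /L -numEsg.
have sg1 : sg ^+ 2 = 1 by rewrite sqr_sg l0.
have Lsg : l * sg = L by rewrite -sgL mulrAC -expr2 sg1 mul1r.
pose phi := frame p u sg.
have phi0 : phi (0, 0) = p by rewrite /phi /frame /= !mul0r !subr0 !addr0 -surjective_pairing.
have phiq t : phi (t * L, r + e) = (q.1 + t * d.1, q.2 + t * d.2).
  rewrite /phi /frame /= uE.1 uE.2 dE.1 dE.2 -sgL.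
  by congr pair; ring.
have phiq0 : phi (0, r + e) = q.
  by have := phiq 0; rewrite !mul0r !addr0 -surjective_pairing.
have closedQ' : closed (phi @^-1` Q) := @closed_frame _ _ _ _ u1 sg1 _ cQ.
have conicQ' z : (phi @^-1` Q) z -> locally_conic (phi @^-1` Q) z.
  by move=> Qz; apply: locally_conic_frame => //; exact: conic.
apply: (no_tangential_covering er closedQ' conicQ' L0).
- move=> t /andP[t0 tL] /=.
  have := phiq (t / L); rewrite divfK ?gt_eqF // => ->; apply: Qd.
  by rewrite divr_ge0 ?(ltW L0) //= ler_pdivrMr // mul1r.
- by apply/fits_frame => //; rewrite -/phi phi0.
- move=> c /fits_frame fc; rewrite -(sqdist_frame p u1 sg1) -/phi phiq0.
  by apply: far; apply: fc.
move=> delta delta0.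
have [|h [c [/andP[h0]]]] := pP (Num.min (delta / L) (delta / 2)).
  by rewrite lt_min !divr_gt0.
rewrite !lt_min => /andP[hL _] /andP[_ c1] /andP[_ c2] fc hc.
exists (h * L), (unframe p u sg c).
rewrite distrC in c1; rewrite distrC in c2.
have [_ _ k1 k2] := frame_coord_bound u1 sg1 c1 c2.
split => //.
- by rewrite mulr_gt0 //= -ltr_pdivlMr.
- by apply/fits_frame => //; rewrite frameK.
- by rewrite -(sqdist_frame p u1 sg1) frameK // -/phi phiq.
Qed.

(** * Finitely many centers suffice *)

Lemma sqdist_continuous (R : realType) (q : plane R) : continuous (sqdist q).
Proof.
move=> x; rewrite /sqdist; apply: cvgD; rewrite expr2;
  under eq_fun do rewrite expr2.
  by apply: cvgM; (apply: cvgB; [exact: cvg_cst|exact: cvg_fst]).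
by apply: cvgM; (apply: cvgB; [exact: cvg_cst|exact: cvg_snd]).
Qed.

Lemma compact_circle_section (R : realType) (Q : set (plane R)) (q : plane R) (s : R) :
  0 <= s -> closed Q -> compact (Q `&` [set x | sqdist q x = s ^+ 2]).
Proof.
move=> s0 cQ; pose M := `|q.1| + `|q.2| + s.
apply: (@closed_bounded_compact _ _ M) => [|x [_ /= qx]].
  apply: closedI => //; apply: (@preimage_closed _ _ (sqdist q) [set s ^+ 2]).
    by move=> x _; exact: sqdist_continuous.
  exact: closed_eq.
have [|h1 h2] := @sqdist_le_box _ q x s s0; first by rewrite qx.
have tri (a b : R) : `|a - b| <= s -> `|b| <= `|a| + s.
  by move=> ab; rewrite (_ : b = a - (a - b)) ?(le_trans (ler_normB _ _)) ?lerD2l //; ring.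
have := tri _ _ h1; have := tri _ _ h2.
by have := normr_ge0 q.1; have := normr_ge0 q.2; rewrite /M; split; lra.
Qed.

Definition finitely_covered (R : realType) (C A : set (plane R)) (s : R) :=
  exists2 F : seq (plane R), (forall c, c \in F -> C c) &
    forall x, A x -> exists2 c, c \in F & sqdist x c <= s ^+ 2.

(** A backward center for one direction covers initial pieces, of a common length, of the rays in
    all nearby directions; the directions form a compact set. *)
Lemma directions_finitely_covered (R : realType) (Q : set (plane R)) (e r rho : R)
    (q : plane R) :
  0 < e < r -> closed Q -> (forall x, Q x -> locally_conic Q x) ->
  (forall x, Q x -> exists2 c, fits Q e r c & sqdist x c <= (r + e) ^+ 2) ->
  (forall c, fits Q e r c -> (r + e) ^+ 2 <= sqdist q c) ->
  0 < rho ->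
  (forall x, Q x -> sqdist q x = rho ^+ 2 ->
    forall t, 0 <= t <= 1 -> Q (q.1 + t * (x.1 - q.1), q.2 + t * (x.2 - q.2))) ->
  exists2 F : seq (plane R), (forall c, c \in F -> fits Q e r c) &
    exists2 t0 : R, 0 < t0 & forall x t, Q x -> sqdist q x = rho ^+ 2 -> 0 < t <= t0 ->
      exists2 c, c \in F &
        sqdist (q.1 + t * (x.1 - q.1), q.2 + t * (x.2 - q.2)) c <= (r + e) ^+ 2.
Proof.
move=> er cQ conic near far rho0 star.
pose K := Q `&` [set x | sqdist q x = rho ^+ 2].
pose G (A : set (plane R)) :=
  exists2 F : seq (plane R), (forall c, c \in F -> fits Q e r c) &
    exists2 t0 : R, 0 < t0 & forall x t, A x -> 0 < t <= t0 ->
      exists2 c, c \in F &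
        sqdist (q.1 + t * (x.1 - q.1), q.2 + t * (x.2 - q.2)) c <= (r + e) ^+ 2.
suff [F FC [t0 t00 FK]] : G K.
  by exists F => //; exists t0 => // x t Qx qx; exact: FK.
apply: compact_ideal_local.
- by apply: compact_circle_section => //; exact: ltW.
- by exists [::] => //; exists 1.
- move=> A B AB [F FC [t0 t00 FB]]; exists F => //; exists t0 => // x t /AB; exact: FB.
- move=> A B [F FC [t0 t00 FA]] [F' FC' [t1 t10 FB]]; exists (F ++ F').
    by move=> c; rewrite mem_cat => /orP[/FC|/FC'].
  exists (Num.min t0 t1); first by rewrite lt_min t00.
  move=> x t ABx /andP[tt]; rewrite le_min => /andP[tt0 tt1].
  case: ABx => [Ax|Bx].
    have [|c cF xc] := FA x t Ax; first by rewrite tt.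
    by exists c => //; rewrite mem_cat cF.
  have [|c cF xc] := FB x t Bx; first by rewrite tt.
  by exists c => //; rewrite mem_cat cF orbT.
move=> x [Qx qx].
have [||c [fc qc]] := @exists_backward_center _ Q e r q (x.1 - q.1, x.2 - q.2) er cQ conic near far.
- apply/eqP => -[/eqP x1 /eqP x2]; move: qx; rewrite /sqdist /=.
  move: x1 x2; rewrite !subr_eq0 => /eqP -> /eqP ->.
  by rewrite !subrr expr0n addr0 => /eqP; rewrite eq_sym sqrf_eq0 gt_eqF.
- by move=> t; exact: star.
rewrite /=; set g := (X in X < 0) => g0.
(* For [y] in the box of half-width [- g / (2 * N)] around [x], the scalar product of [y - q] and
   [q - c] is at most [g / 2]. Going from [q] to parameter [t] then adds at most
   [t * (g + t * rho ^+ 2)] to the squared distance to [c]. *)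
pose N := `|q.1 - c.1| + `|q.2 - c.2| + 1.
have N0 : 0 < N by rewrite /N -addrA ltr_wpDl // ltr_wpDl.
exists [set y | `|x.1 - y.1| < - g / (2 * N) /\ `|x.2 - y.2| < - g / (2 * N)].
  by apply/nbhs_boxP; exists (- g / (2 * N)) => //; rewrite divr_gt0 ?mulr_gt0 // oppr_gt0.
exists [:: c]; first by move=> c'; rewrite inE => /eqP ->.
exists (- g / rho ^+ 2); first by rewrite divr_gt0 ?exprn_gt0 ?oppr_gt0.
move=> y t [[_ qy] [xy1 xy2]] /andP[t0]; rewrite ler_pdivlMr ?exprn_gt0 // => tg.
exists c; first by rewrite inE.
move: xy1 xy2; rewrite !ltr_pdivlMr ?mulr_gt0 // => xy1 xy2.
have lower (a b : R) : - (a * b) <= `|a| * `|b| by rewrite -normrM -normrN ler_norm.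
have := lower (x.1 - y.1) (q.1 - c.1); have := lower (x.2 - y.2) (q.2 - c.2).
have n1 := normr_ge0 (x.1 - y.1); have n2 := normr_ge0 (x.2 - y.2).
have n3 := normr_ge0 (q.1 - c.1); have n4 := normr_ge0 (q.2 - c.2).
move=> l2 l1.
have dg : 2 * ((y.1 - q.1) * (q.1 - c.1) + (y.2 - q.2) * (q.2 - c.2)) <= g.
  have b1 : `|x.1 - y.1| * `|q.1 - c.1| * (2 * N) <= - g * `|q.1 - c.1|.
    by rewrite mulrAC ler_wpM2r // ltW.
  have b2 : `|x.2 - y.2| * `|q.2 - c.2| * (2 * N) <= - g * `|q.2 - c.2|.
    by rewrite mulrAC ler_wpM2r // ltW.
  have b3 : 2 * (`|x.1 - y.1| * `|q.1 - c.1| + `|x.2 - y.2| * `|q.2 - c.2|) <= - g.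
    by rewrite -(ler_pM2r N0); rewrite /N in b1 b2 *; lra.
  by move: b3 l1 l2; rewrite /g; lra.
move: qc qy; rewrite /sqdist /= => qc qy.
have : t * (2 * ((y.1 - q.1) * (q.1 - c.1) + (y.2 - q.2) * (q.2 - c.2)) + t * rho ^+ 2) <= 0.
  by rewrite pmulr_rle0 //; lra.
by rewrite -qy; lra.
Qed.

(** A center closer than [r + e] covers a whole neighbourhood of [q]. If there is none, the centers
    found for the directions at [q], and one for [q] itself, do. *)
Lemma locally_finitely_covered (R : realType) (Q : set (plane R)) (e r : R)
    (q : plane R) :
  0 < e < r -> closed Q -> (forall x, Q x -> locally_conic Q x) ->
  (forall x, Q x -> exists2 c, fits Q e r c & sqdist x c <= (r + e) ^+ 2) ->
  Q q -> exists2 V, nbhs q V & finitely_covered (fits Q e r) (Q `&` V) (r + e).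
Proof.
move=> er cQ conic near Qq; have /andP[e0 er'] := er.
have s0 : 0 < r + e by lra.
have [[c fc qc]|/forall2NP far] :=
    pselect (exists2 c, fits Q e r c & sqdist q c < (r + e) ^+ 2).
  (* Here [[set c]] takes the place of [Q], and [r + e] that of [e]. *)
  have [t t0 tP] := @covers_near_gap _ [set c] _ q c s0 erefl qc.
  exists [set y | `|q.1 - y.1| < t /\ `|q.2 - y.2| < t].
    by apply/nbhs_boxP; exists t.
  exists [:: c]; first by move=> c'; rewrite inE => /eqP ->.
  move=> x [_ [x1 x2]]; exists c; first by rewrite inE.
  by have [||_ -> //] := tP x; rewrite distrC ltW.
have {}far c : fits Q e r c -> (r + e) ^+ 2 <= sqdist q c.
  by move=> fc; case: (far c) => // /negP; rewrite -leNgt.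
have [rho rho0 cone] := conic q Qq.
pose sg := rho / 2; have sg0 : 0 < sg by rewrite /sg; lra.
have in_cone x : sqdist q x = sg ^+ 2 -> `|x.1 - q.1| < rho /\ `|x.2 - q.2| < rho.
  move=> qx; have [|h1 h2] := @sqdist_le_box _ q x sg (ltW sg0); first by rewrite qx.
  by rewrite distrC [`|x.2 - _|]distrC /sg in h1 h2 *; split; lra.
have unshift (x : plane R) : (q.1 + (x.1 - q.1), q.2 + (x.2 - q.2)) = x.
  by case: x => ? ? /=; congr pair; ring.
have [|F FC [t0 t00 FK]] := directions_finitely_covered er cQ conic near far sg0.
  move=> x Qx /in_cone[x1 x2] t /andP[]; rewrite le_eqVlt => /predU1P[<- _|t_gt0 t1].
    by rewrite !mul0r !addr0 -surjective_pairing.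
  by apply/(cone _ _ t x1 x2); rewrite ?t_gt0 // unshift.
have [c0 fc0 qc0] := near q Qq.
(* Points of the box are within [2 * eta] of [q], so each one other than [q] lies at a parameter at
   most [t0] and at most 1 on the way from [q] to its radial projection onto the circle of radius
   [sg]. *)
pose eta := Num.min t0 1 * sg / 2.
have eta0 : 0 < eta by rewrite /eta divr_gt0 ?mulr_gt0 ?lt_min ?t00 //=.
exists [set y | `|q.1 - y.1| < eta /\ `|q.2 - y.2| < eta].
  by apply/nbhs_boxP; exists eta.
exists (c0 :: F); first by move=> c; rewrite inE => /predU1P[->//|/FC].
move=> x [Qx [x1 x2]].
have [qx0|qxn0] := eqVneq (sqdist q x) 0.
  exists c0; rewrite ?mem_head // (_ : x = q) //.
  move: qx0 => /eqP; rewrite /sqdist paddr_eq0 ?sqr_ge0 // !sqrf_eq0 !subr_eq0.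
  by case: x q {x1 x2 Qx Qq cone in_cone unshift FK qc0 far} => ? ? [? ?] /= /andP[/eqP -> /eqP ->].
pose n := edistance q x.
have n0 : 0 < n by rewrite sqrtr_gt0 lt_def qxn0 sqdist_ge0.
have nE : n ^+ 2 = sqdist q x by rewrite sqr_sqrtr // sqdist_ge0.
have n_eta : n <= 2 * eta.
  rewrite edistance_le; last by lra.
  have sq (a : R) : `|a| < eta -> a ^+ 2 <= eta ^+ 2.
    by move=> ha; rewrite -real_normK ?num_real // ler_sqr ?nnegrE // ltW.
  by have := sq _ x1; have := sq _ x2; have := sqr_ge0 eta; rewrite /sqdist; lra.
have [n_t0 n_sg] : n / sg <= t0 /\ n / sg <= 1.
  have : n / sg <= Num.min t0 1.
    rewrite ler_pdivrMr //; apply: le_trans n_eta _.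
    by rewrite /eta mulrC divfK.
  by rewrite le_min => /andP[].
have t_gt0 : 0 < n / sg by rewrite divr_gt0.
pose y : plane R := (q.1 + sg / n * (x.1 - q.1), q.2 + sg / n * (x.2 - q.2)).
have qy : sqdist q y = sg ^+ 2.
  transitivity ((sg / n) ^+ 2 * sqdist q x); first by rewrite /sqdist /=; ring.
  by rewrite -nE expr_div_n divfK // expf_neq0 // gt_eqF.
have xE : x = (q.1 + n / sg * (y.1 - q.1), q.2 + n / sg * (y.2 - q.2)).
  rewrite -[LHS]unshift /=; congr pair; field; rewrite !gt_eqF //.
have Qy : Q y.
  have [y1 y2] := in_cone _ qy; rewrite -(unshift y).
  by apply/(cone _ _ (n / sg) y1 y2); rewrite ?t_gt0 // -xE.
have [|c cF xc] := FK y (n / sg) Qy qy; first by rewrite t_gt0.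
by exists c; rewrite ?inE ?cF ?orbT // xE.
Qed.

Lemma finite_centers (R : realType) (Q : set (plane R)) (e r : R) :
  0 < e < r -> closed Q -> compact Q -> (forall x, Q x -> locally_conic Q x) ->
  (forall x, Q x -> exists2 c, fits Q e r c & sqdist x c <= (r + e) ^+ 2) ->
  finitely_covered (fits Q e r) Q (r + e).
Proof.
move=> er cQ kQ conic near.
apply: (@compact_ideal_local _ _ (fun A => finitely_covered (fits Q e r) A (r + e))) => //.
- by exists [::].
- by move=> A B AB [F FC FB]; exists F => // x /AB; exact: FB.
- move=> A B [F FC FA] [F' FC' FB]; exists (F ++ F').
    by move=> c; rewrite mem_cat => /orP[/FC|/FC'].
  move=> x [/FA|/FB] [c cF xc]; exists c => //; rewrite mem_cat cF ?orbT //.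
- by move=> q Qq; exact: locally_finitely_covered.
Qed.

(** * Polygonal regions are locally conic *)

Lemma continuous_to_plane (R : realType) (f g : R -> R) :
  continuous f -> continuous g -> continuous (fun t => (f t, g t) : plane R).
Proof. by move=> cf cg t; exact: (cvg_pair (cf t) (cg t)). Qed.

Lemma closed_segment (R : realType) (a b : plane R) : closed (segment a b).
Proof.
apply: compact_closed; first exact: norm_hausdorff.
apply: continuous_compact; last exact: segment_compact.
apply: continuous_subspaceT.
by apply: continuous_to_plane => t; apply: cvgD; apply: cvgM;
  [apply: cvgB; [exact: cvg_cst|exact: cvg_id]|exact: cvg_cst|exact: cvg_id|exact: cvg_cst
  |apply: cvgB; [exact: cvg_cst|exact: cvg_id]|exact: cvg_cst|exact: cvg_id|exact: cvg_cst].
Qed.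

Lemma locally_conic_notin (R : realType) (S : set (plane R)) (q : plane R) :
  closed S -> ~ S q -> locally_conic S q.
Proof.
move=> cS nSq; have /nbhs_boxP[rho rho0 out] : nbhs q (~` S).
  by apply: open_nbhs_nbhs; split => //; exact: closed_openC.
have nS a b : `|a| < rho -> `|b| < rho -> ~ S (q.1 + a, q.2 + b).
  by move=> ha hb; apply: out; rewrite /= opprD addrA subrr sub0r normrN.
exists rho => // a b t ha hb /andP[t0 t1]; split=> [/(nS _ _ ha hb)//|].
have shrink (c : R) : `|c| < rho -> `|t * c| < rho.
  move=> hc; apply: le_lt_trans hc; rewrite normrM (gtr0_norm t0).
  by rewrite ler_piMl.
by move/nS => H; case: H; exact: shrink.
Qed.

Lemma locally_conic_segment (R : realType) (a b q : plane R) :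
  locally_conic (segment a b) q.
Proof.
have [[tau tau01 <-]|nq] := pselect (segment a b q); last first.
  by apply: locally_conic_notin => //; exact: closed_segment.
move: tau01; rewrite /= in_itv /= => /andP[tau0 tau1].
pose N := `|b.1 - a.1| + `|b.2 - a.2|.
have [N0|N0] := eqVneq N 0.
  move: N0 => /eqP; rewrite /N paddr_eq0 // !normr_eq0 !subr_eq0 => /andP[/eqP b1 /eqP b2].
  exists 1 => // c d t _ _ /andP[t0 _]; rewrite b1 b2.
  have cst s : ((1 - s) * a.1 + s * a.1 = a.1) * ((1 - s) * a.2 + s * a.2 = a.2).
    by split; ring.
  rewrite !cst; split=> -[s s01] /=; rewrite b1 b2 !cst => -[h1 h2];
    exists s => //=; rewrite b1 b2 !cst.
    have -> : c = 0 by lra.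
    by have -> : d = 0 by [lra]; rewrite !mulr0 !addr0.
  have : t * c = 0 by lra.
  move=> /eqP; rewrite mulf_eq0 gt_eqF //= => /eqP ->.
  have : t * d = 0 by lra.
  by move=> /eqP; rewrite mulf_eq0 gt_eqF //= => /eqP ->; rewrite !addr0.
have {}N0 : 0 < N by rewrite lt_def N0 addr_ge0.
(* The parameter distance from [q] to the nearest endpoint other than [q]; an endpoint equal to [q]
   imposes no bound, whence the default 1. *)
pose m := Num.min (if tau == 1 then 1 else 1 - tau) (if tau == 0 then 1 else tau).
have m0 : 0 < m.
  rewrite /m lt_min; apply/andP; split; case: eqVneq => [_|t1]; rewrite ?ltr01 //.
    by rewrite subr_gt0 lt_def eq_sym t1.
  by rewrite lt_def t1.
have m1 : tau < 1 -> m <= 1 - tau.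
  by move=> t1; rewrite /m ge_min lt_eqF //= lexx.
have m2 : 0 < tau -> m <= tau.
  by move=> t1; rewrite /m ge_min [tau == 0]gt_eqF //= lexx orbT.
exists (m * N / 2); first by rewrite divr_gt0 ?mulr_gt0.
move=> c d t hc hd /andP[t0 t1].
have on (s : R) : (1 - s) * a.1 + s * b.1 = a.1 + s * (b.1 - a.1) by ring.
have on' (s : R) : (1 - s) * a.2 + s * b.2 = a.2 + s * (b.2 - a.2) by ring.
split=> -[s]; rewrite /= in_itv /= => /andP[s0 s1]; rewrite !on !on' => -[h1 h2].
  exists (tau + t * (s - tau)); rewrite /= ?in_itv /= ?on ?on'.
    by apply/andP; split; nra.
  have -> : c = (s - tau) * (b.1 - a.1) by lra.
  have -> : d = (s - tau) * (b.2 - a.2) by lra.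
  by congr pair; ring.
pose th := (s - tau) / t.
have thE : t * th = s - tau by rewrite /th mulrC divfK // gt_eqF.
have cE : c = th * (b.1 - a.1).
  by apply: (mulfI (x := t)); rewrite ?gt_eqF // mulrA thE; lra.
have dE : d = th * (b.2 - a.2).
  by apply: (mulfI (x := t)); rewrite ?gt_eqF // mulrA thE; lra.
have thm : `|th| < m.
  rewrite -(ltr_pM2r N0); move: hc hd; rewrite cE dE !normrM /N.
  by lra.
move: thm; rewrite ltr_norml => /andP[thl thu].
exists (tau + th); rewrite /= ?in_itv /= ?on ?on'; last first.
  by rewrite cE dE; congr pair; ring.
have [taup|tau_le] := ltP 0 tau; have [tau_lt|tau_ge] := ltP tau 1.
- by have := m1 tau_lt; have := m2 taup; move=> ? ?; apply/andP; split; lra.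
- have : t * th <= 0 by rewrite thE; lra.
  by rewrite pmulr_rle0 // => th0; have := m2 taup; move=> ?; apply/andP; split; lra.
- have : 0 <= t * th by rewrite thE; lra.
  by rewrite pmulr_rge0 // => th0; have := m1 tau_lt; move=> ?; apply/andP; split; lra.
- by lra.
Qed.

Lemma locally_conic_bigcup (R : realType) (n : nat) (S : 'I_n -> set (plane R))
    (q : plane R) :
  (forall i, locally_conic (S i) q) ->
  locally_conic (\bigcup_(i in [set: 'I_n]) S i) q.
Proof.
move=> H.
have /choice[rho rhoP] : forall i, exists rho : R, 0 < rho /\
    forall a b t : R, `|a| < rho -> `|b| < rho -> 0 < t <= 1 ->
    S i (q.1 + a, q.2 + b) <-> S i (q.1 + t * a, q.2 + t * b).
  by move=> i; have [rho] := H i; exists rho.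
(* The default 1 keeps the radius positive when the union is empty. *)
exists (\big[Num.min/1]_i rho i).
  by apply: lt_bigmin => // i _; have [] := rhoP i.
move=> a b t ha hb t01.
have small (c : R) i : `|c| < \big[Num.min/1]_i rho i -> `|c| < rho i.
  by move=> hc; apply: lt_le_trans hc _; exact: bigmin_le.
by split=> -[i _ Si]; exists i => //; move: Si;
  rewrite ((rhoP i).2 a b t (small _ _ ha) (small _ _ hb) t01).
Qed.

(* A short ray from [q] that misses the conic set [boundary Q] off its apex
   stays on one side of it. *)
Lemma locally_conic_polygonal (R : realType) (Q : set (plane R)) (q : plane R) :
  polygonal_region Q -> locally_conic Q q.
Proof.
move=> [cQ [n [a [b [_ bQ]]]]].
have [rho rho0 cone] : locally_conic (boundary Q) q.
  by rewrite bQ; apply: locally_conic_bigcup => i; exact: locally_conic_segment.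
have bdQ x : boundary Q x -> Q x by move=> [+ _]; exact: cQ.
exists rho => // c d t hc hd t01.
have [bd|nbd] := pselect (boundary Q (q.1 + c, q.2 + d)).
  by split => _; apply: bdQ => //; apply/(cone c d t).
pose f (s : R) : plane R := (q.1 + s * c, q.2 + s * d).
have cf : continuous f.
  by apply: continuous_to_plane => s; (apply: cvgD; [exact: cvg_cst|]);
    apply: cvgM; [exact: cvg_id|exact: cvg_cst|exact: cvg_id|exact: cvg_cst].
have f1 : f 1 = (q.1 + c, q.2 + d) by rewrite /f !mul1r.
pose I : set R := [set` `]0, 1]].
have It : I t by rewrite /I /= in_itv.
have I1 : I 1 by rewrite /I /= in_itv /= ltr01 lexx.
have offbd s : I s -> ~ boundary Q (f s).
  by rewrite /I /= in_itv /= => s01 /(cone c d s hc hd s01).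
have cI : connected I by apply/connected_intervalP; exact: interval_is_interval.
(* Off the boundary, a point of [Q] is interior, so the trace of [Q] on the ray is both open and
   closed in the connected set [I]. *)
have side s : I s -> Q (f s) -> I = I `&` (f @^-1` Q).
  move=> Is Qs; symmetry; apply: cI.
  - by exists s.
  - exists (f @^-1` interior Q).
      by apply: open_comp => [x _|]; [exact: cf|exact: open_interior].
    apply/seteqP; split=> x [Ix Qx]; split => //; last exact: (interior_subset Qx).
    apply: contrapT => nint; apply: (offbd x Ix); split => //.
    exact: subset_closure.
  - by exists (f @^-1` Q) => //; apply: preimage_closed => // x _; exact: cf.
rewrite -f1 -/(f t); split=> [/(side _ I1)|/(side _ It)] IE.
  by have := It; rewrite IE => -[].
by have := I1; rewrite IE => -[].
Qed.

(** * Finite sets as polygonal regions *)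

Lemma segment_point (R : realType) (a : plane R) : segment a a = [set a].
Proof.
apply/seteqP; split=> [x [t _ <-]|x ->].
  by rewrite -!mulrDl !subrK !mul1r -surjective_pairing.
exists 0; first by rewrite /= in_itv /= lexx ler01.
by rewrite subr0 !mul1r !mul0r !addr0 -surjective_pairing.
Qed.

Lemma segment_interior_point (R : realType) (a x : plane R) :
  segment_interior a a x -> x = a.
Proof. by move=> [t _ <-]; rewrite -!mulrDl !subrK !mul1r -surjective_pairing. Qed.

Lemma interior_finite_plane (R : realType) (F : seq (plane R)) :
  interior [set x | x \in F] = set0.
Proof.
apply/seteqP; split=> // x /nbhs_boxP[d d0 dF].
(* Infinitely many points of the box; starting the denominators at 2 keeps the shift strictly below
   [d]. *)
pose g (i : nat) : plane R := (x.1 + d / i.+2%:R, x.2).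
have g_inj : injective g.
  move=> i j [] /addrI /(mulfI (lt0r_neq0 d0)) /invr_inj /eqP.
  by rewrite eqr_nat => /eqP[].
have := @uniq_leq_size _ [seq g i | i <- iota 0 (size F).+1] F.
rewrite size_map size_iota ltnn => H; suff : false by []; apply: H.
  by rewrite map_inj_uniq // iota_uniq.
move=> y /mapP[i _ ->]; apply: dF; rewrite /g /= ?subrr ?normr0 //.
rewrite opprD addrA subrr sub0r normrN gtr0_norm ?divr_gt0 ?ltr0n //.
by rewrite ltr_pdivrMr ?ltr0n // ltr_pMr // ltr1n.
Qed.

Lemma polygonal_region_finite (R : realType) (F : seq (plane R)) :
  polygonal_region [set x | x \in F].
Proof.
have cF : closed [set x | x \in F].
  elim: F => [|a F IH].
    by rewrite (_ : [set x | _] = set0) //; [exact: closed0|apply/seteqP; split].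
  rewrite (_ : [set x | _] = [set a] `|` [set x | x \in F]).
    apply: closedU => //; apply: compact_closed; first exact: norm_hausdorff.
    exact: compact_set1.
  by apply/seteqP; split=> x; rewrite /= inE => /predU1P.
split=> //.
(* The relative interior of a degenerate segment is its point, so a repeated point would violate
   disjointness. *)
pose s := undup F.
exists (size s), (fun i => nth 0 s i), (fun i => nth 0 s i); split.
  move=> i j _ _ [x [/segment_interior_point -> /segment_interior_point /eqP]].
  by rewrite nth_uniq ?undup_uniq // => /eqP /val_inj.
rewrite /boundary -(closure_id _).1 // interior_finite_plane setD0.
apply/seteqP; split=> [x /= xF|x [i _]].
  have xs : x \in s by rewrite mem_undup.
  have ix : (index x s < size s)%N by rewrite index_mem.
  by exists (Ordinal ix) => //=; rewrite segment_point nth_index.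
by rewrite segment_point => ->; rewrite /= -mem_undup mem_nth.
Qed.

(** * Hausdorff distance, offsets and the algorithm *)

Lemma distance_to_set_le (R : realType) (Y : set (plane R)) (x y : plane R) (e : R) :
  0 <= e -> Y y -> sqdist x y <= e ^+ 2 -> (distance_to_set x Y <= e%:E)%E.
Proof.
move=> e0 Yy xy; apply: le_trans (_ : _ <= (edistance x y)%:E)%E _.
  by apply: ereal_inf_lbound; exists y.
by rewrite lee_fin edistance_le.
Qed.

(** Points of [Y] that almost realize the infimum stay bounded and accumulate in the closed set
    [Y]. *)
Lemma distance_to_set_attained (R : realType) (Y : set (plane R)) (x : plane R) (e : R) :
  closed Y -> 0 <= e -> (distance_to_set x Y <= e%:E)%E -> covers Y e x.
Proof.
move=> cY e0 dx.
have close h : 0 < h -> exists2 y, Y y & sqdist x y <= (e + h) ^+ 2.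
  move=> h0; have : (distance_to_set x Y < (e + h)%:E)%E.
    by apply: le_lt_trans dx _; rewrite lte_fin ltrDl.
  move=> /ereal_inf_lt[_ [y Yy <-]]; rewrite lte_fin => xy; exists y => //.
  by rewrite -edistance_le; [exact: ltW|lra].
pose P h y := sqdist x y <= (e + h) ^+ 2.
have [d d0|y Yy yP] := @closed_small_parameter _ Y x (e + 1) P cY.
  have [h [h0 hd h1]] := small_positive d0 ltr01.
  have [y Yy xy] := close h h0; exists h, y.
  have [|y1 y2] := sqdist_le_box _ xy; first by lra.
  by split => //; rewrite ?h0 //; lra.
exists y => //; rewrite -edistance_le //; apply/ler_addgt0Pr => h h0.
rewrite edistance_le; last by lra.
apply: sqdist_limit => d d0; have [|k [z [/andP[k0]]]] := yP (Num.min d h).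
  by rewrite lt_min d0.
rewrite !lt_min => /andP[kd kh] /andP[z1 _] /andP[z2 _] Yz xz.
exists x, z; split; rewrite ?subrr ?normr0 //.
apply: le_trans xz _; rewrite ler_sqr ?nnegrE; lra.
Qed.

Lemma sqdist_triangle (R : realType) (x y z : plane R) (s t : R) :
  0 <= s -> 0 <= t -> sqdist x y <= s ^+ 2 -> sqdist y z <= t ^+ 2 ->
  sqdist x z <= (s + t) ^+ 2.
Proof.
move=> s0 t0 xy yz.
set a := (x.1 - y.1, x.2 - y.2); set b := (y.1 - z.1, y.2 - z.2).
have cs : a.1 * b.1 + a.2 * b.2 <= s * t.
  apply: le_trans (ler_norm _) _.
  rewrite -ler_sqr ?nnegrE ?mulr_ge0 // real_normK ?num_real //.
  apply: (@le_trans _ _ (sqdist x y * sqdist y z)).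
    by rewrite /sqdist; have := sqr_ge0 (a.1 * b.2 - a.2 * b.1); rewrite /a /b /=; nra.
  by rewrite exprMn ler_pM // sqdist_ge0.
by move: xy yz cs; rewrite /sqdist /a /b /=; lra.
Qed.

Lemma eps_closeP (R : realType) (e : R) (X Y : set (plane R)) :
  eps_close e X Y <->
  (forall x, X x -> (distance_to_set x Y <= e%:E)%E) /\
  (forall y, Y y -> (distance_to_set y X <= e%:E)%E).
Proof.
rewrite /eps_close /hausdorff_distance ge_max; split=> [/andP[XY YX]|[XY YX]].
  split=> x Zx; [apply: le_trans XY|apply: le_trans YX];
    by apply: ereal_sup_ubound; exists x.
by apply/andP; split; apply: ge_ereal_sup => _ [x Zx <-]; [exact: XY|exact: YX].
Qed.

(** Closedness makes the infima attained, and offsetting by [r] and then by [e] amounts to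
    offsetting by [r + e]. *)
Lemma eps_close_offset (R : realType) (Q P : set (plane R)) (e r : R) :
  0 < e -> 0 < r -> closed Q -> closed P ->
  eps_close e (offset P r) Q <->
  (forall c, P c -> fits Q e r c) /\ (forall x, Q x -> covers P (r + e) x).
Proof.
move=> e0 r0 cQ cP; have [e0' r0'] := (ltW e0, ltW r0).
rewrite eps_closeP; split=> [[PQ QP]|[PQ QP]].
  split=> [c Pc z zc|x Qx].
    by apply: distance_to_set_attained => //; apply: PQ; apply/offsetP => //; exists c.
  have cO : closed (offset P r).
    move=> z clz; apply/offsetP => //; apply: covers_limit => // d d0.
    have [|y [/offsetP -/(_ r0') Py [y1 y2]]] :=
        clz [set y | `|z.1 - y.1| < d /\ `|z.2 - y.2| < d].
      by apply/nbhs_boxP; exists d.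
    by exists y.
  have [y /offsetP -/(_ r0') [c Pc yc] xy] := distance_to_set_attained cO e0' (QP x Qx).
  by exists c => //; rewrite addrC; exact: sqdist_triangle xy yc.
split=> [x /offsetP -/(_ r0') [c Pc xc]|x Qx].
  by have [y Qy xy] := PQ c Pc x xc; exact: distance_to_set_le xy.
have [c Pc xc] := QP x Qx.
have s0 : 0 < r + e by lra.
have scale (k : R) (v w : plane R) : sqdist v w = (k / (r + e)) ^+ 2 * sqdist x c ->
    sqdist v w <= k ^+ 2.
  move=> ->; apply: (@le_trans _ _ ((k / (r + e)) ^+ 2 * (r + e) ^+ 2)).
    by rewrite ler_wpM2l ?sqr_ge0.
  by rewrite expr_div_n divfK // expf_neq0 // gt_eqF.
(* The point dividing the segment from [c] to [x] in the ratio [r : e]. *)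
pose y : plane R := (c.1 + r / (r + e) * (x.1 - c.1), c.2 + r / (r + e) * (x.2 - c.2)).
apply: (@distance_to_set_le _ _ _ y) => //.
  apply/offsetP => //; exists c => //; apply: scale.
  by rewrite /sqdist /=; ring.
by apply: scale; rewrite /sqdist /=; field; rewrite gt_eqF.
Qed.

Lemma decideP (R : realType) (Q : set (plane R)) (r e : R) : 0 < r -> 0 < e ->
  decide Q r e = true <->
  forall x, Q x -> exists2 c, fits Q e r c & sqdist x c <= (r + e) ^+ 2.
Proof.
move=> r0 e0; have [r0' e0'] := (ltW r0, ltW e0).
have s0 : 0 <= r + e by rewrite addr_ge0.
have insetE c : inset (offset Q e) r c <-> fits Q e r c.
  by rewrite insetP //; split=> H z /H /offsetP; apply.
rewrite /decide; split=> [/asboolP H x /H /offsetP -/(_ s0) [c /insetE fc xc]|H].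
  by exists c.
apply/asboolP => x /H[c fc xc]; apply/offsetP => //.
by exists c => //; apply/insetE.
Qed.

Theorem corollary6 (R : realType) (Q : set (plane R)) (r eps : R) :
  polygonal_region Q -> Q !=set0 -> bounded_set Q -> 0 < r -> 0 < eps ->
  (decide Q r eps = true <->
   exists P : set (plane R), polygonal_region P /\ eps_close eps (offset P r) Q).
Proof.
move=> pQ _ bQ r0 e0; have cQ : closed Q by case: pQ.
rewrite decideP //; split=> [near|[P [pP PQ]] x Qx]; last first.
  have [cP _] := pP; have [fP QP] := (eps_close_offset e0 r0 cQ cP).1 PQ.
  by have [c /fP fc xc] := QP x Qx; exists c.
have [re|er] := leP r eps.
  exists Q; split=> //; apply/eps_close_offset => //; split=> [c Qc z zc|x Qx].
    by exists c => //; apply: le_trans zc _; rewrite ler_sqr ?nnegrE // ltW.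
  by exists x => //; rewrite /sqdist !subrr expr0n addr0 sqr_ge0.
have kQ : compact Q.
  have [M [_ MQ]] := bQ; apply: (@closed_bounded_compact _ _ (M + 1)) => // x Qx.
  have := MQ (M + 1) _ x Qx; rewrite ltrDl => /(_ ltr01).
  by rewrite /= prod_normE /= ge_max => /andP[].
have er' : 0 < eps < r by rewrite e0.
have [|F fF QF] := @finite_centers _ Q eps r er' cQ kQ _ near.
  by move=> x _; exact: locally_conic_polygonal.
have pF := polygonal_region_finite F; have [cF _] := pF.
exists [set x | x \in F]; split => //.
by apply/eps_close_offset.
Qed.
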